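(* Let $\omega\in\mathbb{R}$, let $F:\mathbb{R}\to\mathbb{R}$ be smooth, and let $\psi:\mathbb{S}^2\to\mathbb{R}$ be a (classical) solution of $$\Delta\psi = F(\psi)-2\omega\sin\theta \quad\text{on } \mathbb{S}^2 .$$ If $F'>-6$, then $\psi$ is a zonal flow modulo a rotation in $\mathbb{O}(3)$; that is, there is $G\in\mathbb{O}(3)$ such that $X\mapsto\psi(GX)$ is zonal.
   Context: $\mathbb{S}^2\subset\mathbb{R}^3$ is the unit sphere with its standard metric, with points $(\cos\varphi\cos\theta,\sin\varphi\cos\theta,\sin\theta)$, where $\varphi\in[0,2\pi)$ is the longitude and $\theta\in[-\frac{\pi}{2},\frac{\pi}{2}]$ the latitude. $\Delta=\partial_\theta^2-\tan\theta\,\partial_\theta+\frac{1}{\cos^2\theta}\partial_\varphi^2$ is the Laplace-Beltrami operator on $\mathbb{S}^2$. A function on $\mathbb{S}^2$ is called zonal if it depends only on the latitude $\theta$. *)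

(* Defs.v *)
From HB Require Import structures.
From mathcomp Require Import all_boot all_order all_algebra.
From mathcomp Require Import all_classical all_reals all_analysis.

Set Implicit Arguments.
Unset Strict Implicit.
Unset Printing Implicit Defensive.

Import Order.TTheory GRing.Theory Num.Theory.
Import numFieldNormedType.Exports.

Local Open Scope ring_scope.
Local Open Scope classical_set_scope.

Definition smooth {R : realType} (F : R -> R) : Prop :=
  forall (n : nat) (t : R), derivable (derive1n n F) t 1.

Definition partial {R : realType} (i : 'I_3) (f : 'cV[R]_3 -> R)
  : 'cV[R]_3 -> R := fun X => 'D_(delta_mx i 0) f X.

Definition C1_on {R : realType} (U : set 'cV[R]_3) (f : 'cV[R]_3 -> R) : Prop :=
  forall (i : 'I_3) (X : 'cV[R]_3), U X ->
    derivable f X (delta_mx i 0) /\ {for X, continuous (partial i f)}.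

Definition C2_on {R : realType} (U : set 'cV[R]_3) (f : 'cV[R]_3 -> R) : Prop :=
  C1_on U f /\ forall i : 'I_3, C1_on U (partial i f).

Definition sphere2 {R : realType} : set 'cV[R]_3 :=
  [set X : 'cV[R]_3 | \sum_(i < 3) X i 0 ^+ 2 = 1].

(* A function on the sphere is represented by a function on the ambient space
   whose values off the sphere are irrelevant: every notion below depends only
   on the restriction of [psi] to [sphere2].  Regularity on the embedded
   submanifold is the existence of a C^2 extension to an open neighbourhood;
   [psi] itself need not be differentiable in the ambient space. *)
Definition C2_sphere {R : realType} (psi : 'cV[R]_3 -> R) : Prop :=
  exists (U : set 'cV[R]_3) (f : 'cV[R]_3 -> R),
    [/\ open U, sphere2 `<=` U, C2_on U f & forall X, sphere2 X -> f X = psi X].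

Definition sphere_point {R : realType} (phi theta : R) : 'cV[R]_3 :=
  \col_(i < 3) [:: cos phi * cos theta; sin phi * cos theta; sin theta]`_i.

(* The coordinate expression of the Laplace-Beltrami operator, at the point of
   longitude [phi] and latitude [theta]; meaningful only for [cos theta != 0],
   i.e. away from the poles. *)
Definition laplace_beltrami {R : realType} (psi : 'cV[R]_3 -> R)
    (phi theta : R) : R :=
  let u := fun p t => psi (sphere_point p t) in
  derive1n 2 (fun t => u phi t) theta
  - tan theta * derive1 (fun t => u phi t) theta
  + (cos theta ^+ 2)^-1 * derive1n 2 (fun p => u p theta) phi.

(* The equation is imposed where the coordinates are regular.  For [psi] of
   class C^2 both sides extend continuously to the whole sphere, so this is the
   equation on the sphere, poles included.  Letting [phi] range over all reals
   rather than [0, 2 pi) changes nothing, by periodicity. *)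
Definition classical_solution {R : realType} (omega : R) (F : R -> R)
    (psi : 'cV[R]_3 -> R) : Prop :=
  C2_sphere psi /\
  forall phi theta : R, - (pi / 2) < theta < pi / 2 ->
    laplace_beltrami psi phi theta =
      F (psi (sphere_point phi theta)) - 2 * omega * sin theta.

Definition zonal {R : realType} (f : 'cV[R]_3 -> R) : Prop :=
  exists g : R -> R, forall phi theta : R, - (pi / 2) <= theta <= pi / 2 ->
    f (sphere_point phi theta) = g theta.

Definition orthogonal_mx {R : realType} (G : 'M[R]_3) : Prop :=
  G^T *m G = 1%:M.

(* Main.v *)
Require Import Defs.
From HB Require Import structures.
From mathcomp Require Import all_boot all_order all_algebra.
From mathcomp Require Import all_classical all_reals all_analysis.
From mathcomp Require Import ring lra.

Import Order.TTheory GRing.Theory Num.Theory.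
Import numFieldNormedType.Exports.

Local Open Scope ring_scope.
Local Open Scope classical_set_scope.

Set Implicit Arguments.
Unset Strict Implicit.
Unset Printing Implicit Defensive.

(** The equation is invariant under the rotations about an axis [a] that either
    carries the Coriolis term or is arbitrary when [omega = 0].  Let [w] be the
    difference between the solution and its image under such a rotation.  By
    the mean value theorem [w] solves [Lap w = c * w] with a function [c > - 6],
    so that the Dirichlet energy of [w] is less than six times its squared norm
    unless [w = 0].  The eigenvalues of [- Lap] are 0, 2, 6, ..., hence [w = 0] as
    soon as [w] is orthogonal to the constants and to the three coordinate
    functions, and then the solution is zonal about [a].  Finite rotations are
    used rather than the infinitesimal one because [w] is of class C^2 whenever
    the solution is.

    Orthogonality to the constants and to the coordinate along [a] is
    automatic.  Orthogonality to the two other coordinates holds if the vector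
    [m] of the first moments of the solution is parallel to [a].

    - If [omega <> 0], [a] is the polar axis.  Multiplying the equation by the
      derivative of the solution along the rotations about a horizontal axis
      turns every term but the Coriolis one into a divergence; what remains says
      that the corresponding component of [m] vanishes ([pohozaev_identity],
      [moments_of_rotation]).
    - If [omega = 0], a rotation about the polar axis and then one about the
      first axis bring [m] to the polar axis.  Along the second family the first
      moment is constant and the two others solve the harmonic oscillator,
      because the generator of the rotations is skew-adjoint
      ([rotation_by_parts], [rotation_kills_moment2]).

    The spectral gap ([spectral_gap]) is elementary.  For fixed latitude [w]
    is split into its first harmonics [A * cos p + B * sin p] and a remainder
    [r].  The remainder satisfies a Wirtinger inequality with constant 4
    ([wirtinger_circle]) and completing the square against [cos t ^+ 2], the
    latitude profile of the second harmonics, gives the constant 6.  For [A] and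
    [B] one completes the square against [sin t * cos t] after subtracting the
    multiple of [cos t] that makes them vanish at the equator
    ([harmonic_flux_le]).  Thus the energy density along each parallel is bounded
    by the derivative of a flux that vanishes at both poles, up to terms that
    integrate to the moments ([energy_le_flux]).

    Integrals over the sphere are iterated: [circ] is the integral over a
    parallel, [lat] the integral over latitudes.  Functions of class C^2 near the
    sphere enter through [chart_of], which provides their derivatives in
    longitude and latitude after a rotation; [ambient_lap] expresses the
    Laplacian without coordinates and so gives its invariance
    ([chart_of_lap]). *)

(** * Calculus of real functions *)

(** Kept apart from [is_derive], which is a class: as an ordinary hypothesis it
    can be left to a rewriting lemma without triggering instance search. *)
Definition has_derivative (R : realType) (F f : R -> R) :=
  forall x, is_derive x (1:R) F (f x).

Lemma is_derive1_add (R : realType) (f g : R -> R) (x a b : R) :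
  is_derive x (1:R) f a -> is_derive x (1:R) g b ->
  is_derive x (1:R) (fun y => f y + g y) (a + b).
Proof. exact: is_deriveD. Qed.

Lemma is_derive1_opp (R : realType) (f : R -> R) (x a : R) :
  is_derive x (1:R) f a -> is_derive x (1:R) (fun y => - f y) (- a).
Proof. exact: is_deriveN. Qed.

Lemma is_derive1_mul (R : realType) (f g : R -> R) (x a b : R) :
  is_derive x (1:R) f a -> is_derive x (1:R) g b ->
  is_derive x (1:R) (fun y => f y * g y) (a * g x + f x * b).
Proof.
move=> Df Dg; have D := is_deriveM Df Dg.
by apply: is_derive_eq; rewrite /GRing.scale /= addrC mulrC.
Qed.

Lemma is_derive1_exp (R : realType) (f : R -> R) (n : nat) (x a : R) :
  is_derive x (1:R) f a ->
  is_derive x (1:R) (fun y => f y ^+ n) (n%:R * f x ^+ n.-1 * a).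
Proof.
move=> Df; have D := is_deriveX n Df.
rewrite (_ : (fun y => f y ^+ n) = f ^+ n) //.
by apply/funext => y; rewrite fctE.
Qed.

Lemma is_derive1_inv (R : realType) (f : R -> R) (x a : R) : f x != 0 ->
  is_derive x (1:R) f a ->
  is_derive x (1:R) (fun y => (f y)^-1) (- a / f x ^+ 2).
Proof.
move=> fx0 Df; have D := is_deriveV fx0 Df.
by apply: is_derive_eq; rewrite /GRing.scale /= mulrC mulrN mulNr.
Qed.

Lemma is_derive1_compo (R : realType) (f g : R -> R) (x a b : R) :
  is_derive x (1:R) g b -> is_derive (g x) (1:R) f a ->
  is_derive x (1:R) (fun y => f (g y)) (a * b).
Proof. by move=> Dg Df; exact: is_derive1_comp. Qed.

Lemma is_derive1_cst (R : realType) (c x : R) :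
  is_derive x (1:R) (fun=> c) (0:R).
Proof. exact: is_derive_cst. Qed.

Lemma is_derive1_id (R : realType) (x : R) :
  is_derive x (1:R) (fun y => y) (1:R).
Proof. exact: is_derive_id. Qed.

Lemma is_derive1_eq (R : realType) (f : R -> R) (x a b : R) :
  is_derive x (1:R) f a -> a = b -> is_derive x (1:R) f b.
Proof. by move=> D <-. Qed.

Ltac isd_step :=
  match goal with
  | |- is_derive _ _ (fun _ => ?c) _ => notypeclasses refine (is_derive1_cst c _)
  | |- is_derive _ _ (fun y => @?f y + @?g y) _ =>
      notypeclasses refine (@is_derive1_add _ f g _ _ _ _ _)
  | |- is_derive _ _ (fun y => - @?f y) _ => notypeclasses refine (@is_derive1_opp _ f _ _ _)
  | |- is_derive _ _ (fun y => @?f y * @?g y) _ =>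
      notypeclasses refine (@is_derive1_mul _ f g _ _ _ _ _)
  | |- is_derive _ _ (fun y => @?f y ^+ ?n) _ =>
      notypeclasses refine (@is_derive1_exp _ f n _ _ _)
  | |- is_derive _ _ (fun y => (@?f y)^-1) _ =>
      notypeclasses refine (@is_derive1_inv _ f _ _ _ _)
  | |- is_derive _ _ (fun y => cos (@?f y)) _ =>
      notypeclasses refine (@is_derive1_compo _ cos f _ _ _ _ (is_derive_cos _))
  | |- is_derive _ _ (fun y => sin (@?f y)) _ =>
      notypeclasses refine (@is_derive1_compo _ sin f _ _ _ _ (is_derive_sin _))
  | |- is_derive _ _ (fun y => y) _ => notypeclasses refine (is_derive1_id _)
  | H : has_derivative ?F _ |- is_derive ?x _ ?F _ => exact: (H x)
  | H : has_derivative ?F _ |- is_derive _ _ (fun y => ?F (@?g y)) _ =>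
      notypeclasses refine (@is_derive1_compo _ F g _ _ _ _ (H _))
  | |- is_derive _ _ _ _ => solve [eauto]
  end.

(** Differentiates an arithmetic expression in one real variable by structural
    recursion, leaving the identification of the derivative as last goal. *)
Ltac isd := notypeclasses refine (is_derive1_eq _ _); [repeat isd_step | cbv beta; cbn [Nat.pred]].

Lemma continuous_cst (T : topologicalType) (R : realType) (c : R) :
  continuous (fun _ : T => c).
Proof. by move=> x; exact: cst_continuous. Qed.

Lemma continuous_add (T : topologicalType) (R : realType) (f g : T -> R) :
  continuous f -> continuous g -> continuous (fun x => f x + g x).
Proof. by move=> cf cg x; apply: continuousD; [exact: cf|exact: cg]. Qed.

Lemma continuous_opp (T : topologicalType) (R : realType) (f : T -> R) :
  continuous f -> continuous (fun x => - f x).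
Proof. by move=> cf x; apply: continuousN; exact: cf. Qed.

Lemma continuous_mul (T : topologicalType) (R : realType) (f g : T -> R) :
  continuous f -> continuous g -> continuous (fun x => f x * g x).
Proof. by move=> cf cg x; apply: continuousM; [exact: cf|exact: cg]. Qed.

Lemma continuous_exp (T : topologicalType) (R : realType) (f : T -> R) n :
  continuous f -> continuous (fun x => f x ^+ n).
Proof.
move=> cf; elim: n => [|n IH]; first exact: continuous_cst.
rewrite (_ : (fun x => _) = fun x => f x * f x ^+ n); first exact: continuous_mul.
by apply/funext => x; rewrite exprS.
Qed.

Lemma continuous_compo (T S U : topologicalType) (f : S -> U) (g : T -> S) :
  continuous g -> continuous f -> continuous (fun x => f (g x)).
Proof. by move=> cg cf x; apply: continuous_comp; [exact: cg|exact: cf]. Qed.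

Lemma continuous_pair (T S U : topologicalType) (a : T -> S) (b : T -> U) :
  continuous a -> continuous b -> continuous (fun x => (a x, b x)).
Proof. by move=> ca cb x; apply: cvg_pair; [exact: ca|exact: cb]. Qed.

Lemma continuous_fst (S U : topologicalType) : continuous (@fst S U).
Proof. by move=> x; exact: cvg_fst. Qed.

Lemma continuous_snd (S U : topologicalType) : continuous (@snd S U).
Proof. by move=> x; exact: cvg_snd. Qed.

Definition continuous2 (S T U : topologicalType) (u : S -> T -> U) :=
  continuous (fun p : S * T => u p.1 p.2).

Lemma continuous2_compo (S T U V : topologicalType) (u : S -> T -> U)
    (a : V -> S) (b : V -> T) :
  continuous2 u -> continuous a -> continuous b ->
  continuous (fun x => u (a x) (b x)).
Proof.
by move=> cu ca cb; exact: (continuous_compo (continuous_pair ca cb) cu).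
Qed.

Lemma continuous2_slice (S T U : topologicalType) (u : S -> T -> U) (x : S) :
  continuous2 u -> continuous (u x).
Proof.
move=> cu; apply: (continuous2_compo cu (a := fun=> x) (b := id)).
- by move=> y; exact: cst_continuous.
- by move=> y; exact: cvg_id.
Qed.

Ltac cont_step :=
  match goal with
  | |- continuous2 _ => unfold continuous2; cbv beta
  | |- continuous (fun y => @?f y + @?g y) => apply (@continuous_add _ _ f g)
  | |- continuous (fun y => - @?f y) => apply (@continuous_opp _ _ f)
  | |- continuous (fun y => @?f y * @?g y) => apply (@continuous_mul _ _ f g)
  | |- continuous (fun y => @?f y ^+ ?n) => apply (@continuous_exp _ _ f n)
  | |- continuous (fun y => cos (@?f y)) =>
      apply (@continuous_compo _ _ _ cos f); last exact: continuous_cos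
  | |- continuous (fun y => sin (@?f y)) =>
      apply (@continuous_compo _ _ _ sin f); last exact: continuous_sin
  | |- continuous (fun y => y) => by move=> ?; exact: cvg_id
  | |- continuous (fun y => (@?f y).1) =>
      apply (@continuous_compo _ _ _ fst f); last exact: continuous_fst
  | |- continuous (fun y => (@?f y).2) =>
      apply (@continuous_compo _ _ _ snd f); last exact: continuous_snd
  | |- continuous (fun _ => ?c) => exact: continuous_cst
  | |- continuous _ => solve [eauto]
  | |- continuous (fun y => ?u (@?a y) (@?b y)) =>
      apply (@continuous2_compo _ _ _ _ u a b); [solve [eauto] | | ]
  | |- continuous (fun y => ?u (@?a y)) =>
      apply (@continuous_compo _ _ _ u a); [ | solve [eauto]]
  | |- continuous (?u ?x) => apply (@continuous2_slice _ _ _ u x)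
  end.

(** Structural recursion for continuity, reducing to the continuity of the
    functions of the context. *)
Ltac cont := repeat cont_step.

Section Integral.
Variable R : realType.
Implicit Types (f g G : R -> R) (a b x : R).

Definition intg a b g : R :=
  \int[(@lebesgue_measure R)]_(x in `[a, b]) g x.

Lemma continuous_integrable a b g : continuous g ->
  (@lebesgue_measure R).-integrable `[a, b] (EFin \o g).
Proof.
move=> cg; apply: continuous_compact_integrable; first exact: segment_compact.
exact: continuous_subspaceT.
Qed.

Lemma intgE a b g G : a <= b -> continuous g ->
  has_derivative G g -> intg a b g = G b - G a.
Proof.
move=> ab cg DG; have := ab; rewrite le_eqVlt => /predU1P[->|altb].
  by rewrite /intg set_itv1 Rintegral_set1 subrr.
have cG : continuous G.
  by move=> x; apply/differentiable_continuous/derivable1_diffP; case: (DG x).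
rewrite /intg /Rintegral (continuous_FTC2 altb (F := G)) //.
- exact: continuous_subspaceT.
- split; first by move=> x _; case: (DG x).
  + exact/cvg_at_right_filter/cG.
  + exact/cvg_at_left_filter/cG.
- by move=> x _; rewrite derive1E; case: (DG x).
Qed.

Lemma intg_chasles a b c g : continuous g -> a <= b -> b <= c ->
  intg a c g = intg a b g + intg b c g.
Proof.
move=> cg ab bc; rewrite /intg.
have I := continuous_integrable a c cg.
have := @Rintegral_itvB R g (BLeft a) (BRight c) b I.
rewrite !bnd_simp => /(_ ab bc) E.
rewrite -(@Rintegral_itv_obnd_cbnd R b (BRight c)) -?E; first lra.
apply: integrableS (continuous_integrable b c cg) => //.
exact: subset_itv_oc_cc.
Qed.

(** Integrability is at hand on bounded intervals only, so the base point of the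
    integral moves with [x]; additivity allows freezing it near a given point. *)
Lemma primitive_exists g : continuous g ->
  exists G, has_derivative G g.
Proof.
move=> cg; pose N x : R := - (`|x| + 1).
exists (fun x => intg (N x) x g - intg (N x) 0 g) => x.
have main : is_derive x (1:R) (fun y => intg (N x - 1) y g - intg (N x - 1) 0 g) (g x).
  have x1 : x < x + 1 by rewrite ltrDl.
  have Nx : N x - 1 < x.
    by rewrite /N; have := ler_norm (- x); rewrite normrN; lra.
  have [D E] := continuous_FTC1_closed x1
    (continuous_integrable (N x - 1) (x + 1) cg) Nx (cg x).
  have DE : is_derive x (1:R) (fun y => intg (N x - 1) y g) (g x).
    by apply: (DeriveDef D); rewrite -derive1E; exact: E.
  have := is_derive1_add DE (is_derive_cst (- intg (N x - 1) 0 g) x 1).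
  by rewrite addr0.
apply: (near_eq_is_derive (f := fun y => intg (N x - 1) y g - intg (N x - 1) 0 g)).
near=> y.
  have yx : `|y| < `|x| + 1.
    rewrite -ltrBlDl; apply: le_lt_trans (lerB_dist _ _) _.
    rewrite distrC; near: y; exact: (@cvgr_dist_lt _ _ _ _ _ id x cvg_id).
  have ny := ler_norm (- y); have ny0 := normr_ge0 y.
  rewrite normrN in ny.
  rewrite (@intg_chasles (N x - 1) (N y) y) //; [|rewrite /N; lra..].
  rewrite (@intg_chasles (N x - 1) (N y) 0) //; [|rewrite /N; lra..].
  lra.
Unshelve. all: by end_near. Qed.


End Integral.

Section IntegralTheory.
Variable R : realType.
Implicit Types (f g G : R -> R) (a b x : R).

Lemma is_derive_continuous (g dg : R -> R) :
  has_derivative g dg -> continuous g.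
Proof.
by move=> D x; apply/differentiable_continuous/derivable1_diffP; case: (D x).
Qed.

Lemma intg_primitive a b g : continuous g -> a <= b ->
  exists2 G, has_derivative G g & intg a b g = G b - G a.
Proof.
by move=> cg ab; have [G DG] := primitive_exists cg; exists G => //; exact: intgE.
Qed.

Lemma intg_cst a b (c : R) : a <= b -> intg a b (fun=> c) = c * (b - a).
Proof.
move=> ab; rewrite (@intgE R a b _ (fun x => c * x)) //; first by ring.
- by cont.
- by move=> x; isd; ring.
Qed.

Lemma intg_add a b f g : a <= b -> continuous f -> continuous g ->
  intg a b (fun x => f x + g x) = intg a b f + intg a b g.
Proof.
move=> ab cf cg.
have [F DF ->] := intg_primitive cf ab.
have [G DG ->] := intg_primitive cg ab.
rewrite (@intgE R a b _ (fun x => F x + G x)) //; first by ring.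
- by cont.
- by move=> x; exact: is_derive1_add.
Qed.

Lemma intg_scale a b (c : R) f : a <= b -> continuous f ->
  intg a b (fun x => c * f x) = c * intg a b f.
Proof.
move=> ab cf; have [F DF ->] := intg_primitive cf ab.
rewrite (@intgE R a b _ (fun x => c * F x)) //; first by ring.
- by cont.
- by move=> x; isd; ring.
Qed.

Lemma intg_opp a b f : a <= b -> continuous f ->
  intg a b (fun x => - f x) = - intg a b f.
Proof.
move=> ab cf; rewrite -mulN1r -intg_scale //; congr intg.
by apply/funext => x; rewrite mulN1r.
Qed.

Lemma intg_ge0 a b f : (forall x, a <= x <= b -> 0 <= f x) -> 0 <= intg a b f.
Proof.
by move=> f0; apply: Rintegral_ge0 => x /=; rewrite in_itv /=; exact: f0.
Qed.

Lemma le_intg a b f g : a <= b -> continuous f -> continuous g ->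
  (forall x, a <= x <= b -> f x <= g x) -> intg a b f <= intg a b g.
Proof.
move=> ab cf cg fg; rewrite -subr_ge0 -intg_opp // -intg_add //; last by cont.
by apply: intg_ge0 => x /fg; rewrite subr_ge0.
Qed.

Lemma norm_intg_le a b f (M : R) : a <= b -> continuous f ->
  (forall x, a <= x <= b -> `|f x| <= M) -> `|intg a b f| <= M * (b - a).
Proof.
move=> ab cf fM; rewrite ler_norml -mulNr -!intg_cst //; apply/andP; split;
  by apply: le_intg; [done | cont | cont | move=> x /fM; rewrite ler_norml => /andP[]].
Qed.

Lemma derive_ge0_le (F dF : R -> R) a b : a <= b ->
  (forall x, a < x < b -> is_derive x (1:R) F (dF x)) ->
  (forall x, a < x < b -> 0 <= dF x) ->
  {within `[a, b], continuous F} -> F a <= F b.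
Proof.
move=> ab DF dF0 cF; rewrite -subr_ge0.
have := ab; rewrite le_eqVlt => /predU1P[->|altb]; first by rewrite subrr.
have DF1 x : x \in `]a, b[%R -> is_derive x (1:R) F (dF x).
  by rewrite in_itv; exact: DF.
have [c cab ->] := MVT altb DF1 cF.
apply: mulr_ge0; last by rewrite subr_ge0.
apply: dF0.
by move: cab; rewrite in_itv.
Qed.

(** A primitive of [f] is nondecreasing and has equal values at the ends, hence
    is constant. *)
Lemma intg_eq0 a b f : a <= b -> continuous f ->
  (forall x, a <= x <= b -> 0 <= f x) -> intg a b f = 0 ->
  forall x, a < x < b -> f x = 0.
Proof.
move=> ab cf f0 If x /andP[ax xb].
have [F DF] := primitive_exists cf.
have cF := is_derive_continuous DF.
have mono c d : a <= c -> c <= d -> d <= b -> F c <= F d.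
  move=> ac cd db; apply: (@derive_ge0_le F f) => //.
  - by move=> y /andP[cy yd]; apply: f0; apply/andP; split; lra.
  - exact: continuous_subspaceT.
have Fcst y : a <= y <= b -> F y = F a.
  move=> /andP[ay yb]; move: If; rewrite (intgE ab cf DF) => Fab.
  have := mono a y (lexx _) ay yb; have := mono y b ay yb (lexx _); lra.
have D0 : is_derive x (1:R) F 0.
  apply: (near_eq_is_derive (f := fun=> F a)).
  have xab : x \in `]a, b[%R by rewrite in_itv /= ax xb.
  have := near_in_itvoo xab; apply: filterS => y.
  by rewrite in_itv /= => /andP[ay yb]; rewrite Fcst // !ltW.
by have [_ <-] := DF x; have [_ ->] := D0.
Qed.

(** The tube lemma along the compact interval from [a] to [b]. *)
Lemma compact_unif_continuous (T : topologicalType) (g : T -> R -> R) a b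
    (t0 : T) (e : R) : 0 < e -> continuous2 g ->
  \forall t \near t0, forall x, a <= x <= b -> `|g t0 x - g t x| < e.
Proof.
move=> e0 cg.
have K := (compact_near_coveringP `[a, b]).1 (@segment_compact R a b).
have cover x : `[a, b] x -> \forall x' \near x & t \near t0,
    `|g t0 x' - g t x'| < e.
  move=> _.
  have cf : continuous (fun p : R * T => g t0 p.1 - g p.2 p.1).
    move=> p; apply: continuousB.
    - apply: (continuous_compo _ cg (g := fun p : R * T => (t0, p.1))).
      apply: continuous_pair; first by move=> q; exact: cst_continuous.
      exact: continuous_fst.
    - apply: (continuous_compo _ cg (g := fun p : R * T => (p.2, p.1))).
      by apply: continuous_pair; [exact: continuous_snd|exact: continuous_fst].
  have := cf (x, t0); rewrite /continuous_at /= subrr => /cvgr0_norm_lt.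
  by move=> /(_ _ e0); exact.
have := K T (nbhs t0) (fun t x' => `|g t0 x' - g t x'| < e) (nbhs_filter t0) cover.
apply: (@filterS _ (nbhs t0)) => t Ht x xab.
by apply: (Ht x); rewrite /= in_itv.
Qed.

Lemma intg_continuous (T : topologicalType) (g : T -> R -> R) a b : a <= b ->
  continuous2 g -> continuous (fun t => intg a b (g t)).
Proof.
move=> ab cg t0.
have cgt t : continuous (g t) by cont.
apply/cvgrPdist_lt => e e0.
have e1 : 0 < e / (b - a + 1) by rewrite divr_gt0 //; lra.
near=> t.
rewrite -intg_opp // -intg_add //; last by cont.
apply: le_lt_trans (norm_intg_le (M := e / (b - a + 1)) ab _ _) _.
- by cont.
- move=> x xab; apply: ltW; move: x xab; near: t.
  exact: compact_unif_continuous.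
- rewrite mulrAC ltr_pdivrMr; [nra|lra].
Unshelve. all: by end_near. Qed.

(** Differentiation under the integral sign: the mean value theorem bounds the
    difference quotient by values of the parameter derivative, which is
    uniformly continuous along the compact interval of integration. *)
Lemma is_derive_intg (g dg : R -> R -> R) a b (t0 : R) : a <= b ->
  (forall t, continuous (g t)) -> continuous2 dg ->
  (forall x, has_derivative (g ^~ x) (dg ^~ x)) ->
  is_derive t0 (1:R) (fun t => intg a b (g t)) (intg a b (dg t0)).
Proof.
move=> ab cg cdg Dg.
have cdgt t : continuous (dg t) by cont.
have lim : h^-1 *: (((fun t => intg a b (g t)) \o shift t0) (h *: (1:R))
    - intg a b (g t0)) @[h --> 0^'] --> intg a b (dg t0).
  apply/cvgrPdist_lt => e e0.
  have e1 : 0 < e / (b - a + 1) by rewrite divr_gt0 //; lra.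
  have U := compact_unif_continuous a b t0 e1 cdg.
  have {U} [d /= d0 U] : exists2 d : R, 0 < d & forall t, `|t - t0| < d ->
      forall x, a <= x <= b -> `|dg t0 x - dg t x| < e / (b - a + 1).
    move: U => /nbhs_ballP[d d0 U]; exists d => // t td; apply: U.
    by rewrite /ball /= distrC.
  near=> h.
  have h0 : h != 0 by near: h; exact: nbhs_dnbhs_neq.
  have hd : `|h| < d by near: h; exact: dnbhs0_lt.
  rewrite /= [h *: 1]mulr1 -[h^-1 *: _]/(h^-1 * _).
  rewrite -intg_opp // -(intg_add ab) //; last by cont.
  rewrite -intg_scale //; last by cont.
  rewrite -intg_opp // -?(intg_add ab) //; try by cont.
  apply: le_lt_trans (norm_intg_le (M := e / (b - a + 1)) ab _ _) _.
  - by cont.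
  - move=> x xab; apply: ltW.
    have [c [cd ->]] : exists c, `|c - t0| < d /\
        g (h + t0) x - g t0 x = h * dg c x.
      have cgx : continuous (g ^~ x).
        exact: (is_derive_continuous (Dg x)).
      have [hn|hp|h00] := ltgtP h 0; last by rewrite h00 eqxx in h0.
      + have ht : h + t0 < t0 by lra.
        have [|c + E] := MVT ht (fun t _ => Dg x t); first exact: continuous_subspaceT.
        rewrite in_itv /= => /andP[c1 c2]; exists c; split; last by lra.
        by move: hd; rewrite !ltr_norml => /andP[? ?]; apply/andP; split; lra.
      + have ht : t0 < h + t0 by lra.
        have [|c + E] := MVT ht (fun t _ => Dg x t); first exact: continuous_subspaceT.
        rewrite in_itv /= => /andP[c1 c2]; exists c; split; last by lra.
        by move: hd; rewrite !ltr_norml => /andP[? ?]; apply/andP; split; lra.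
    by rewrite mulKf //; exact: U.
  - rewrite mulrAC ltr_pdivrMr; [nra|lra].
by apply: DeriveDef; [apply/cvg_ex; eexists; exact: lim | exact: cvg_lim].
Unshelve. all: by end_near. Qed.

End IntegralTheory.

(** * Integrals over a circle and the Wirtinger inequality *)

Section Circle.
Variable R : realType.
Implicit Types (g h : R -> R).

Lemma derive_ge0_le_closed (F dF : R -> R) (a b : R) : a <= b ->
  (forall x, a <= x <= b -> is_derive x (1:R) F (dF x)) ->
  (forall x, a <= x <= b -> 0 <= dF x) -> F a <= F b.
Proof.
move=> ab DF dF0; apply: (derive_ge0_le (dF := dF)) => //.
- by move=> x /andP[ax xb]; apply: DF; rewrite !ltW.
- by move=> x /andP[ax xb]; apply: dF0; rewrite !ltW.
- apply: derivable_within_continuous => x; rewrite in_itv /= => /DF.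
  by case.
Qed.

(** Completing the square against [cos (k * (x - m))], with [m] the midpoint:
    for [k < 2] this function has no zero on the closed interval, so that the
    singularities at the ends for [k = 2] do not show up. *)
Lemma dirichlet_quarter_subcritical (s s' : R -> R) (a k : R) : 0 <= k < 2 ->
  has_derivative s s' -> continuous s' -> s a = 0 -> s (a + pi / 2) = 0 ->
  0 <= intg a (a + pi / 2) (fun x => s' x ^+ 2 - k ^+ 2 * s x ^+ 2).
Proof.
move=> /andP[k0 k2] Ds cs' sa sb.
have cs := is_derive_continuous Ds.
have pi0 : 0 < (pi : R) := pi_gt0 R.
have ab : a <= a + pi / 2 by lra.
have cQ : continuous (fun x => s' x ^+ 2 - k ^+ 2 * s x ^+ 2) by cont.
have [G DG ->] := intg_primitive cQ ab.
pose m := a + pi / 4.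
pose c x := cos (k * (x - m)).
pose F x := G x + k * sin (k * (x - m)) / c x * s x ^+ 2.
have c0 x : a <= x <= a + pi / 2 -> c x != 0.
  move=> /andP[ax xb]; rewrite gt_eqF // cos_gt0_pihalf //.
  by apply/andP; split; rewrite /m; nra.
have := @derive_ge0_le_closed F
  (fun x => (s' x + k * sin (k * (x - m)) / c x * s x) ^+ 2) _ _ ab.
rewrite /F sa sb !expr0n /= !mulr0 !addr0 subr_ge0; apply.
- move=> x xab; have cx := c0 x xab; rewrite /c in cx *; isd; first exact: cx.
  by field.
- by move=> x _; exact: sqr_ge0.
Qed.

(** The limit [k -> 2] of the previous inequality. *)
Lemma dirichlet_quarter (s s' : R -> R) (a b : R) : b = a + pi / 2 ->
  has_derivative s s' -> continuous s' -> s a = 0 -> s b = 0 ->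
  0 <= intg a b (fun x => s' x ^+ 2 - 4 * s x ^+ 2).
Proof.
move=> -> Ds cs' sa sb.
have cs := is_derive_continuous Ds.
have pi0 : 0 < (pi : R) := pi_gt0 R.
have ab : a <= a + pi / 2 by lra.
have E (k : R) : intg a (a + pi / 2) (fun x => s' x ^+ 2 - k * s x ^+ 2) =
    intg a (a + pi / 2) (fun x => s' x ^+ 2)
    - k * intg a (a + pi / 2) (fun x => s x ^+ 2).
  by rewrite intg_add ?intg_opp ?intg_scale //; cont.
have B0 : 0 <= intg a (a + pi / 2) (fun x => s x ^+ 2).
  by apply: intg_ge0 => x _; exact: sqr_ge0.
have H k (k02 : 0 <= k < 2) :=
  dirichlet_quarter_subcritical k02 Ds cs' sa sb.
move: B0 H; rewrite E.
move: (intg _ _ (fun x => s' x ^+ 2)) (intg _ _ (fun x => s x ^+ 2)) E => A B E B0 H.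
rewrite leNgt; apply/negP => neg.
have Bp : 0 < 8 * B + (4 * B - A) by lra.
(* A failure of the inequality by [4 * B - A] would already be felt at
   [k = 2 - e]. *)
pose e := (4 * B - A) / (8 * B + (4 * B - A)).
have eE : e * (8 * B + (4 * B - A)) = 4 * B - A by rewrite mulfVK // gt_eqF.
have e0 : 0 < e by rewrite divr_gt0 //; lra.
have e1 : e <= 1 by rewrite ler_pdivrMr //; lra.
have k02 : 0 <= 2 - e < 2 by apply/andP; split; lra.
have := H _ k02; rewrite E.
nra.
Qed.

Definition circ g : R := intg 0 (2 * pi) g.

Lemma two_pi_ge0 : 0 <= 2 * (pi : R).
Proof. by have := pi_gt0 R; lra. Qed.

Lemma cos_2pi : cos (2 * pi) = 1 :> R.
Proof. by rewrite mulr_natl cos2pi. Qed.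

Lemma sin_2pi : sin (2 * pi) = 0 :> R.
Proof. by rewrite mulr_natl sin2pi. Qed.

Lemma cosDtwopi (x : R) : cos (x + 2 * pi) = cos x.
Proof. by rewrite mulr_natl cosD2pi. Qed.

Lemma sinDtwopi (x : R) : sin (x + 2 * pi) = sin x.
Proof. by rewrite mulr_natl sinD2pi. Qed.

Lemma circ_add g h : continuous g -> continuous h ->
  circ (fun x => g x + h x) = circ g + circ h.
Proof. by move=> cg ch; rewrite /circ intg_add // two_pi_ge0. Qed.

Lemma circ_scale (c : R) g : continuous g ->
  circ (fun x => c * g x) = c * circ g.
Proof. by move=> cg; rewrite /circ intg_scale // two_pi_ge0. Qed.

Lemma circ_opp g : continuous g -> circ (fun x => - g x) = - circ g.
Proof. by move=> cg; rewrite /circ intg_opp // two_pi_ge0. Qed.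

Lemma circ_ge0 g : (forall x, 0 <= g x) -> 0 <= circ g.
Proof. by move=> g0; apply: intg_ge0. Qed.

Lemma circE g G : continuous g -> has_derivative G g ->
  circ g = G (2 * pi) - G 0.
Proof. by move=> cg DG; rewrite /circ (intgE two_pi_ge0 cg DG). Qed.

Lemma circ_derivative g G : continuous g -> has_derivative G g ->
  G (2 * pi) = G 0 -> circ g = 0.
Proof. by move=> cg DG E; rewrite (circE cg DG) E subrr. Qed.

Lemma circ_shift (s : R) g : continuous g -> (forall x, g (x + 2 * pi) = g x) ->
  circ (fun x => g (x + s)) = circ g.
Proof.
move=> cg per; have [G DG] := primitive_exists cg.
have D1 : has_derivative (fun x => G (x + s)) (fun x => g (x + s)).
  by move=> x; isd; ring.
rewrite (circE _ D1); last by cont.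
rewrite (circE cg DG) add0r.
have D0 (y : R) : is_derive y (1:R) (fun y => G (2 * pi + y) - G y) 0.
  isd.
  by rewrite (addrC _ y) per; ring.
by have := is_derive_0_is_cst s 0 D0; rewrite addr0.
Qed.

Lemma circ_cst (c : R) : circ (fun=> c) = 2 * pi * c.
Proof. by rewrite /circ intg_cst ?two_pi_ge0 //; ring. Qed.

Lemma circ_cos2 : circ (fun x => cos x ^+ 2) = pi.
Proof.
rewrite (@circE _ (fun x => (x + sin x * cos x) / 2)).
- by rewrite cos_2pi sin_2pi sin0 cos0; field.
- by cont.
- by move=> x; isd; have := cos2Dsin2 x => E; lra.
Qed.

Lemma circ_sin2 : circ (fun x => sin x ^+ 2) = pi.
Proof.
rewrite (@circE _ (fun x => (x - sin x * cos x) / 2)).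
- by rewrite cos_2pi sin_2pi sin0 cos0; field.
- by cont.
- by move=> x; isd; have := cos2Dsin2 x => E; lra.
Qed.

Lemma circ_cossin : circ (fun x => cos x * sin x) = 0.
Proof.
rewrite (@circE _ (fun x => (sin x) ^+ 2 / 2)).
- by rewrite sin_2pi sin0; field.
- by cont.
- by move=> x; isd; field.
Qed.

(** The trigonometric polynomial [T] below interpolates [h] at the four
    multiples of [pi / 2], so that [h - T] satisfies the Dirichlet inequality on
    each quarter.  The frequency-two term of [T] is neutral for the quadratic
    form [circ (h' ^+ 2) - 4 * circ (h ^+ 2)], and the other ones only meet the
    Fourier coefficients of [h] of frequency zero and one. *)
Lemma wirtinger_circle h h' : has_derivative h h' -> continuous h' ->
  h (2 * pi) = h 0 ->
  4 * circ (fun x => h x ^+ 2)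
  - 3 / pi * (circ (fun x => h x * cos x) ^+ 2 + circ (fun x => h x * sin x) ^+ 2)
  - 2 / pi * circ h ^+ 2 <= circ (fun x => h' x ^+ 2).
Proof.
move=> Dh ch' per; have ch := is_derive_continuous Dh.
have pi0 : 0 < (pi : R) := pi_gt0 R.
pose h0 := h 0; pose h1 := h (pi / 2); pose h2 := h pi; pose h3 := h (pi + pi / 2).
pose c := (h0 + h1 + h2 + h3) / 4; pose d := (h0 - h1 + h2 - h3) / 4.
pose a := (h0 - h2) / 2; pose b := (h1 - h3) / 2.
pose T x := c + a * cos x + b * sin x + d * (2 * cos x ^+ 2 - 1).
pose T' x := - a * sin x + b * cos x - 4 * d * (sin x * cos x).
have DT : has_derivative T T' by move=> x; rewrite /T /T'; isd; ring.
pose s x := h x - T x; pose s' x := h' x - T' x.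
have Ds : has_derivative s s' by move=> x; rewrite /s /s'; isd.
have cT' : continuous T' by rewrite /T'; cont.
have cT := is_derive_continuous DT.
have cs' : continuous s' by rewrite /s'; cont.
have cs := is_derive_continuous Ds.
have s_0 : s 0 = 0 by rewrite /s /T cos0 sin0 -/h0 /c /d /a /b; field.
have s_1 : s (pi / 2) = 0.
  by rewrite /s /T cos_pihalf sin_pihalf -/h1 /c /d /a /b; field.
have s_2 : s pi = 0 by rewrite /s /T cospi sinpi -/h2 /c /d /a /b; field.
have s_3 : s (pi + pi / 2) = 0.
  rewrite /s /T -/h3 (addrC pi) cosDpi sinDpi cos_pihalf sin_pihalf /c /d /a /b.
  by field.
have s_4 : s (2 * pi) = 0.
  by rewrite /s /T per cos_2pi sin_2pi -/h0 /c /d /a /b; field.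
pose q x := s' x ^+ 2 - 4 * s x ^+ 2.
have cq : continuous q by rewrite /q; cont.
have Q0 : 0 <= circ q.
  rewrite /circ (@intg_chasles _ 0 (pi / 2)) //; [|lra..].
  rewrite (@intg_chasles _ (pi / 2) pi) //; [|lra..].
  rewrite (@intg_chasles _ pi (pi + pi / 2)) //; [|lra..].
  rewrite !addr_ge0 //; apply: dirichlet_quarter => //; first by ring.
  - by field.
  - by field.
pose L x := 4 * c + 3 * a * cos x + 3 * b * sin x.
have Eq : circ q = circ (fun x => h' x ^+ 2 - 4 * h x ^+ 2)
    + circ (fun x => 2 * (h x * L x)) - circ (fun x => T x * L x).
  pose N x := T' x ^+ 2 - 4 * T x ^+ 2 + T x * L x
    - 2 * (h' x * T' x) + 8 * (h x * T x) - 2 * (h x * L x).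
  have cL : continuous L by rewrite /L; cont.
  have cN : continuous N by rewrite /N; cont.
  have DT' : has_derivative T' (fun x => L x - 4 * T x).
    move=> x; rewrite /T' /L /T; isd.
    transitivity (- a * cos x - b * sin x - 4 * d * (cos x ^+ 2 - sin x ^+ 2)).
      by ring.
    by rewrite sin2cos2; ring.
  have N0 : circ N = 0.
    apply: (circ_derivative (G := fun x => (T x - 2 * h x) * T' x) cN).
    - by move=> x; rewrite /N; isd; ring.
    - by rewrite per /T /T' cos_2pi sin_2pi cos0 sin0.
  pose TL x := T x * L x; pose hL x := 2 * (h x * L x).
  pose Q x := h' x ^+ 2 - 4 * h x ^+ 2.
  have cTL : continuous TL by rewrite /TL; cont.
  have chL : continuous hL by rewrite /hL; cont.
  have cQ : continuous Q by rewrite /Q; cont.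
  have -> : q = fun x => Q x + (hL x + (- TL x + N x)).
    by apply/funext => x; rewrite /q /s /s' /N /Q /hL /TL; ring.
  have c1 : continuous (fun x => - TL x) by cont.
  have c2 : continuous (fun x => - TL x + N x) by cont.
  have c3 : continuous (fun x => hL x + (- TL x + N x)) by cont.
  rewrite (circ_add cQ c3) (circ_add chL c2) (circ_add c1 cN) (circ_opp cTL) N0.
  by rewrite addr0 addrA.
have EhL : circ (fun x => 2 * (h x * L x)) = 8 * c * circ h
    + 6 * a * circ (fun x => h x * cos x) + 6 * b * circ (fun x => h x * sin x).
  have -> : (fun x => 2 * (h x * L x)) = fun x => 8 * c * h x
      + 6 * a * (h x * cos x) + 6 * b * (h x * sin x).
    by apply/funext => x; rewrite /L; ring.
  by rewrite !circ_add ?circ_scale //; cont.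
have ETL : circ (fun x => T x * L x) = 8 * pi * c ^+ 2 + 3 * pi * (a ^+ 2 + b ^+ 2).
  rewrite (@circE _ (fun x => 4 * c ^+ 2 * x + 7 * c * a * sin x
    - 7 * c * b * cos x + 3 * a * b * sin x ^+ 2
    + 3 * a ^+ 2 * (x + sin x * cos x) / 2 + 3 * b ^+ 2 * (x - sin x * cos x) / 2
    + 4 * c * d * (sin x * cos x) + 3 * a * d * (sin x - 2 / 3 * sin x ^+ 3)
    + 3 * b * d * (cos x - 2 / 3 * cos x ^+ 3))).
  - by rewrite cos_2pi sin_2pi sin0 cos0; field.
  - by rewrite /L; cont.
  - move=> x; rewrite /T /L; isd.
    have := cos2Dsin2 x; move: (cos x) (sin x) => C S CS.
    transitivity (4 * c ^+ 2 + 7 * c * a * C + 7 * c * b * S + 6 * a * b * S * C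
      + 3 / 2 * a ^+ 2 * (1 + C ^+ 2 - S ^+ 2)
      + 3 / 2 * b ^+ 2 * (1 - C ^+ 2 + S ^+ 2)
      + 4 * c * d * (C ^+ 2 - S ^+ 2) + 3 * a * d * C * (1 - 2 * S ^+ 2)
      + 3 * b * d * S * (2 * C ^+ 2 - 1)).
      by field.
    transitivity (4 * c ^+ 2 + 7 * c * a * C + 7 * c * b * S + 6 * a * b * S * C
      + 3 * a ^+ 2 * C ^+ 2 + 3 * b ^+ 2 * S ^+ 2
      + (4 * c * d + 3 * a * d * C + 3 * b * d * S) * (2 * C ^+ 2 - 1));
      last by ring.
    have -> : S ^+ 2 = 1 - C ^+ 2 by rewrite -CS; ring.
    by field.
  have EQ : circ (fun x => h' x ^+ 2 - 4 * h x ^+ 2) =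
    circ (fun x => h' x ^+ 2) - 4 * circ (fun x => h x ^+ 2).
  by rewrite circ_add ?circ_opp ?circ_scale //; cont.
move: Q0; rewrite Eq EhL ETL EQ.
move: (circ (fun x => h' x ^+ 2)) (circ (fun x => h x ^+ 2)) (circ h)
  (circ (fun x => h x * cos x)) (circ (fun x => h x * sin x)) => X Y m A B Q0.
suff : 2 / pi * (m - 2 * pi * c) ^+ 2 + 3 / pi * ((A - pi * a) ^+ 2 + (B - pi * b) ^+ 2) >= 0.
  suff -> : 2 / pi * (m - 2 * pi * c) ^+ 2 + 3 / pi * ((A - pi * a) ^+ 2 + (B - pi * b) ^+ 2)
    = 2 / pi * m ^+ 2 + 3 / pi * (A ^+ 2 + B ^+ 2)
      - (8 * c * m + 6 * a * A + 6 * b * B) + (8 * pi * c ^+ 2 + 3 * pi * (a ^+ 2 + b ^+ 2)).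
    by lra.
  by have := lt0r_neq0 pi0; move: (pi : R) => w w0; field.
by rewrite addr_ge0 // mulr_ge0 ?addr_ge0 ?sqr_ge0 ?divr_ge0 // ltW.
Qed.

End Circle.

(** * Functions on the sphere in longitude and latitude *)

Section Chart.
Variable R : realType.

(** A function on the sphere read in longitude [p] and latitude [t], together
    with its derivatives.  [ch_q] is the derivative along the unit eastward
    vector and [ch_lap] the Laplacian; both are continuous up to the poles,
    where the coordinate expressions that define them are singular. *)
Record chart := Chart {
  ch :> R -> R -> R;
  ch_t : R -> R -> R; ch_p : R -> R -> R;
  ch_tt : R -> R -> R; ch_tp : R -> R -> R; ch_pp : R -> R -> R;
  ch_q : R -> R -> R; ch_lap : R -> R -> R;
  ch_cont : continuous2 ch; ch_t_cont : continuous2 ch_t;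
  ch_p_cont : continuous2 ch_p; ch_tt_cont : continuous2 ch_tt;
  ch_tp_cont : continuous2 ch_tp; ch_pp_cont : continuous2 ch_pp;
  ch_q_cont : continuous2 ch_q; ch_lap_cont : continuous2 ch_lap;
  ch_dt : forall p, has_derivative (ch p) (ch_t p);
  ch_dp : forall t, has_derivative (ch ^~ t) (ch_p ^~ t);
  ch_dtt : forall p, has_derivative (ch_t p) (ch_tt p);
  ch_dtp : forall t, has_derivative (ch_t ^~ t) (ch_tp ^~ t);
  ch_dpt : forall p, has_derivative (ch_p p) (ch_tp p);
  ch_dpp : forall t, has_derivative (ch_p ^~ t) (ch_pp ^~ t);
  ch_qE : forall p t, ch_p p t = cos t * ch_q p t;
  ch_per : forall p t, ch (p + 2 * pi) t = ch p t;
  ch_t_per : forall p t, ch_t (p + 2 * pi) t = ch_t p t;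
  ch_p_per : forall p t, ch_p (p + 2 * pi) t = ch_p p t;
  ch_lapE : forall p t, cos t != 0 ->
    ch_lap p t = ch_tt p t - tan t * ch_t p t + (cos t ^+ 2)^-1 * ch_pp p t
}.

Definition lat (g : R -> R) : R := intg (- (pi / 2)) (pi / 2) g.

Lemma lat_le : - (pi / 2) <= pi / 2 :> R.
Proof. by have := pi_gt0 R; lra. Qed.

Lemma latitude_interior (t : R) : - (pi / 2) <= t <= pi / 2 -> cos t != 0 ->
  - (pi / 2) < t < pi / 2.
Proof.
move=> /andP[t1 t2] ct; rewrite !lt_neqAle t1 t2 !andbT; apply/andP; split.
- by apply: contra ct => /eqP <-; rewrite cosN cos_pihalf.
- by apply: contra ct => /eqP ->; rewrite cos_pihalf.
Qed.

Lemma continuous2_flip (S T U : topologicalType) (u : S -> T -> U) :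
  continuous2 u -> continuous2 (fun y x => u x y).
Proof.
move=> cu; apply: (continuous2_compo cu (a := fun p => p.2) (b := fun p => p.1)).
- exact: continuous_snd.
- exact: continuous_fst.
Qed.

Lemma circ_continuous (T : topologicalType) (g : R -> T -> R) :
  continuous2 g -> continuous (fun t => circ (g ^~ t)).
Proof.
by move=> /continuous2_flip cg; exact: (intg_continuous (two_pi_ge0 R) cg).
Qed.

Lemma is_derive_circ (g dg : R -> R -> R) : continuous2 g -> continuous2 dg ->
  (forall p, has_derivative (g p) (dg p)) ->
  has_derivative (fun t => circ (g ^~ t)) (fun t => circ (dg ^~ t)).
Proof.
move=> /continuous2_flip cg /continuous2_flip cdg D t.
apply: (is_derive_intg (g := fun t p => g p t) (dg := fun t p => dg p t)) => //.
- exact: two_pi_ge0.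
- by move=> s; exact: (@continuous2_slice R R R (fun t p => g p t) s cg).
Qed.

(** All longitudes denote the same point at a pole: [ch_p = cos * ch_q] vanishes
    there. *)
Lemma chart_pole (h : chart) (p t : R) : cos t = 0 -> h p t = h 0 t.
Proof.
move=> ct; apply: (is_derive_0_is_cst (f := h ^~ t)) => x.
by apply: (is_derive1_eq (ch_dp h t x)); rewrite ch_qE ct mul0r.
Qed.

(** The singularity is removable because [s / sin] has a limit while [s] tends
    to zero; the value at [0] is right thanks to the convention [x / 0 = 0]. *)
Lemma sqr_over_sin_continuous (s s' : R -> R) : has_derivative s s' -> s 0 = 0 ->
  {for 0, continuous (fun t => s t ^+ 2 / sin t)}.
Proof.
move=> Ds s0; have cs := is_derive_continuous Ds.
have quot (f : R -> R) (l : R) : is_derive (0:R) (1:R) f l -> f 0 = 0 ->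
    f h / h @[h --> (0:R)^'] --> l.
  move=> [df <-] f0; have := df; rewrite /derivable => cf.
  have -> : (fun h => f h / h) =
      fun h => h^-1 *: ((f \o shift 0) (h *: (1:R)) - f 0).
    apply/funext => h; rewrite /= f0 subr0 addr0 [h *: 1]mulr1.
    by rewrite -[h^-1 *: _]/(h^-1 * _) mulrC.
  exact: cf.
have Q1 := quot s (s' 0) (Ds 0) s0.
have sin1 : is_derive (0:R) (1:R) (@sin R) 1.
  by apply: (is_derive1_eq (is_derive_sin 0)); rewrite cos0.
have Q2 := quot sin 1 sin1 (sin0 R).
have Q3 : s h @[h --> (0:R)^'] --> (0:R).
  by have := cs 0; rewrite /continuous_at s0 => cs0; exact: cvg_within_filter.
have Q : s h * (s h / h) / (sin h / h) @[h --> (0:R)^'] --> (0:R) * s' 0 / 1.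
  by apply: cvgM; [exact: cvgM|apply: cvgV => //; exact: oner_neq0].
rewrite mul0r mul0r in Q.
apply/continuous_withinNx; rewrite s0 expr0n /= mul0r.
apply: cvg_trans Q; apply: near_eq_cvg; near=> h.
have h0 : h != 0 by near: h; exact: nbhs_dnbhs_neq.
rewrite invf_div expr2 -!mulrA; congr (_ * (_ * _)).
by rewrite mulrA mulVf // mul1r.
Unshelve. all: by end_near. Qed.

End Chart.

(** * The spectral gap of the Laplacian *)

Section FirstHarmonic.
Variable R : realType.
Implicit Types (A : R -> R) (b t : R).

(** What is left under a total derivative when the square is completed in the
    energy of the harmonic [A t * cos p].  With [b = A 0] the function
    [s = A - b * cos] vanishes at the equator, as the ground state [sin * cos]
    does: the first term comes from the square of [s], the second one from the
    cross term between [s] and [b * cos]. *)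
Definition harmonic_flux A b t : R :=
  (cos t ^+ 2 / sin t - sin t) * (A t - b * cos t) ^+ 2
  - 2 * b * (sin t * cos t * (A t - b * cos t)).

Definition harmonic_flux' A A' b t : R :=
  (- 3 * cos t - cos t ^+ 3 / sin t ^+ 2) * (A t - b * cos t) ^+ 2
  + (cos t ^+ 2 / sin t - sin t) *
    (2 * (A t - b * cos t) * (A' t + b * sin t))
  - 2 * b * ((cos t ^+ 2 - sin t ^+ 2) * (A t - b * cos t)
             + sin t * cos t * (A' t + b * sin t)).

Lemma is_derive_harmonic_flux A A' b t : has_derivative A A' -> sin t != 0 ->
  is_derive t (1:R) (harmonic_flux A b) (harmonic_flux' A A' b t).
Proof.
move=> DA s0; rewrite /harmonic_flux /harmonic_flux'; isd; first exact: s0.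
by field.
Qed.

Lemma harmonic_flux_pole A b t : cos t = 0 -> A t = 0 -> harmonic_flux A b t = 0.
Proof. by move=> c0 A0; rewrite /harmonic_flux c0 A0; ring. Qed.

Lemma harmonic_flux_continuous0 A A' : has_derivative A A' ->
  {for 0, continuous (harmonic_flux A (A 0))}.
Proof.
move=> DA; pose s t := A t - A 0 * cos t.
have Ds : has_derivative s (fun t => A' t + A 0 * sin t).
  by move=> t; rewrite /s; isd; ring.
have cs := is_derive_continuous Ds.
have s0 : s 0 = 0 by rewrite /s cos0 mulr1 subrr.
have E : harmonic_flux A (A 0) = fun t => cos t ^+ 2 * (s t ^+ 2 / sin t)
    + (- (sin t * s t ^+ 2) - 2 * A 0 * (sin t * cos t * s t)).
  by apply/funext => t; rewrite /harmonic_flux -/(s t); ring.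
have c1 : continuous (fun t : R => cos t ^+ 2) by cont.
have c2 : continuous
    (fun t => - (sin t * s t ^+ 2) - 2 * A 0 * (sin t * cos t * s t)) by cont.
rewrite E /continuous_at; apply: cvgD; last exact: c2.
apply: cvgM; first exact: c1.
exact: (sqr_over_sin_continuous Ds s0).
Qed.

(** Completing the square against the ground state [sin * cos] of the first
    harmonic: for [s = A - b * cos] the difference of the two sides is
    [cos * (s' - (cos / sin - sin / cos) * s) ^+ 2] plus
    [b ^+ 2 * (2 * cos + cos ^+ 3)]. *)
Lemma harmonic_flux_le A A' b t : 0 < cos t -> sin t != 0 ->
  harmonic_flux' A A' b t <=
  cos t * A' t ^+ 2 + A t ^+ 2 / cos t - 6 * cos t * A t ^+ 2
  + 8 * b * (cos t ^+ 2 * A t).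
Proof.
move=> c0 s0; have cn0 : cos t != 0 := lt0r_neq0 c0.
rewrite -subr_ge0 /harmonic_flux'.
have := cos2Dsin2 t; move: (cos t) (sin t) (A t) (A' t) c0 s0 cn0.
move=> C S a a' C0 S0 Cn0 CS.
have -> : a ^+ 2 / C = a ^+ 2 * (C ^+ 2 + S ^+ 2) / C by rewrite CS mulr1.
set X := (X in 0 <= X).
have -> : X = C * (a' + b * S - (C / S - S / C) * (a - b * C)) ^+ 2
    + b ^+ 2 * (2 * C * (C ^+ 2 + S ^+ 2) + C ^+ 3).
  by rewrite /X; field; apply/andP.
rewrite CS addr_ge0 // mulr_ge0 ?sqr_ge0 ?(ltW C0) //.
by rewrite mulr1 addr_ge0 ?exprn_ge0 ?mulr_ge0 // ltW.
Qed.

End FirstHarmonic.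

Section Gap.
Variables (R : realType) (h : chart R).

Let ht := ch_t h. Let hp := ch_p h.
Let c_h : continuous2 h := @ch_cont R h.
Let c_ht : continuous2 ht := @ch_t_cont R h.
Let c_hp : continuous2 hp := @ch_p_cont R h.
Let c_htt : continuous2 (ch_tt h) := @ch_tt_cont R h.
Let c_hpp : continuous2 (ch_pp h) := @ch_pp_cont R h.
Let c_lap : continuous2 (ch_lap h) := @ch_lap_cont R h.

Let P t := circ (fun p => h p t ^+ 2).
Let V t := circ (fun p => h p t * ht p t).
Let K t := circ (fun p => ht p t ^+ 2).
Let N t := circ (fun p => h p t * ch_tt h p t).
Let W t := circ (fun p => hp p t ^+ 2).
Let A t := circ (fun p => h p t * cos p) / pi.
Let B t := circ (fun p => h p t * sin p) / pi.
Let A' t := circ (fun p => ht p t * cos p) / pi.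
Let B' t := circ (fun p => ht p t * sin p) / pi.

Let pi_neq0 : (pi : R) != 0.
Proof. exact: lt0r_neq0 (pi_gt0 R). Qed.

Lemma derive_sqr_mean : has_derivative P (fun t => 2 * V t).
Proof.
move=> t; rewrite /V -circ_scale; last by cont.
apply: (is_derive_circ (g := fun p t => h p t ^+ 2)
  (dg := fun p t => 2 * (h p t * ht p t))); [by cont|by cont|].
by move=> p s; have D := ch_dt h p; isd; rewrite -/ht; ring.
Qed.

Lemma derive_sqr_mean2 : has_derivative V (fun t => K t + N t).
Proof.
move=> t; rewrite /K /N -circ_add; [|by cont..].
apply: (is_derive_circ (g := fun p t => h p t * ht p t)
  (dg := fun p t => ht p t ^+ 2 + h p t * ch_tt h p t)); [by cont|by cont|].
move=> p s; have D := ch_dt h p; have D2 := ch_dtt h p.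
by rewrite /ht; isd; ring.
Qed.

Lemma derive_fourier (f : R -> R) : continuous f ->
  has_derivative (fun t => circ (fun p => h p t * f p) / pi)
                 (fun t => circ (fun p => ht p t * f p) / pi).
Proof.
move=> cf t.
have D : has_derivative (fun t => circ (fun p => h p t * f p))
    (fun t => circ (fun p => ht p t * f p)).
  apply: (is_derive_circ (g := fun p t => h p t * f p)
    (dg := fun p t => ht p t * f p)); [by cont|by cont|].
  by move=> p s; have D := ch_dt h p; isd; rewrite /ht; ring.
by isd; ring.
Qed.

Lemma circ_lap t : cos t != 0 ->
  circ (fun p => h p t * ch_lap h p t + 6 * h p t ^+ 2) =
  N t - tan t * V t - W t / cos t ^+ 2 + 6 * P t.
Proof.
move=> ct.
have by_parts : circ (fun p => hp p t ^+ 2 + h p t * ch_pp h p t) = 0.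
  apply: (circ_derivative (G := fun p => h p t * hp p t)); first by cont.
  - move=> p; have D := ch_dp h t; have D2 := ch_dpp h t.
    by rewrite /hp; isd; ring.
  - have := ch_per h 0 t; have := ch_p_per h 0 t.
    by rewrite /hp !add0r => -> ->.
have -> : (fun p => h p t * ch_lap h p t + 6 * h p t ^+ 2) = fun p =>
    h p t * ch_tt h p t + (- tan t * (h p t * ht p t)
    + ((cos t ^+ 2)^-1 * (hp p t ^+ 2 + h p t * ch_pp h p t)
    + (- (cos t ^+ 2)^-1 * hp p t ^+ 2 + 6 * h p t ^+ 2))).
  by apply/funext => p; rewrite ch_lapE // -/ht; ring.
do 4 (rewrite circ_add; [|by cont..]).
rewrite !circ_scale; [|by cont..].
by rewrite by_parts -/(P t) -/(V t) -/(N t) -/(W t); ring.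
Qed.

Hypothesis mean0 : forall t, circ (fun p => h p t) = 0.

(** The circle inequality on the parallel of latitude [t]. *)
Lemma longitude_energy t : 4 * P t - 3 * pi * (A t ^+ 2 + B t ^+ 2) <= W t.
Proof.
have cp : continuous (fun p => hp p t) by cont.
have per : h (2 * pi) t = h 0 t by have := ch_per h 0 t; rewrite add0r.
have := wirtinger_circle (ch_dp h t) cp per; rewrite mean0 -/(P t) -/(W t).
have -> : circ (fun p => h p t * cos p) = pi * A t by rewrite /A mulrC divfK.
have -> : circ (fun p => h p t * sin p) = pi * B t by rewrite /B mulrC divfK.
apply: le_trans; rewrite expr0n /= mulr0 subr0 lerD2l lerN2.
have gen (w x y : R) : w != 0 ->
    3 / w * ((w * x) ^+ 2 + (w * y) ^+ 2) = 3 * w * (x ^+ 2 + y ^+ 2).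
  by move=> w0; field.
by rewrite gen.
Qed.

(** The square of [r_t + k * r] has nonnegative integral over a parallel, where
    [r = h - A * cos - B * sin] is [h] without its first harmonics. *)
Lemma latitude_energy t (k : R) :
  pi * (A' t + k * A t) ^+ 2 + pi * (B' t + k * B t) ^+ 2 <=
  K t + 2 * k * V t + k ^+ 2 * P t.
Proof.
pose a := A' t + k * A t; pose b := B' t + k * B t.
have : 0 <= circ (fun p => (ht p t + k * h p t - a * cos p - b * sin p) ^+ 2).
  by apply: circ_ge0 => p; exact: sqr_ge0.
have -> : (fun p => (ht p t + k * h p t - a * cos p - b * sin p) ^+ 2) = fun p =>
    ht p t ^+ 2 + (2 * k * (h p t * ht p t) + (k ^+ 2 * h p t ^+ 2
    + ((- 2 * a) * (ht p t * cos p) + ((- 2 * b) * (ht p t * sin p)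
    + ((- 2 * k * a) * (h p t * cos p) + ((- 2 * k * b) * (h p t * sin p)
    + (a ^+ 2 * cos p ^+ 2 + (b ^+ 2 * sin p ^+ 2
    + 2 * a * b * (cos p * sin p))))))))).
  by apply/funext => p; ring.
do 9 (rewrite circ_add; [|by cont..]).
rewrite !circ_scale; [|by cont..].
rewrite circ_cos2 circ_sin2 circ_cossin -/(P t) -/(V t) -/(K t).
have -> : circ (fun p => h p t * cos p) = pi * A t by rewrite /A mulrC divfK.
have -> : circ (fun p => h p t * sin p) = pi * B t by rewrite /B mulrC divfK.
have -> : circ (fun p => ht p t * cos p) = pi * A' t by rewrite /A' mulrC divfK.
have -> : circ (fun p => ht p t * sin p) = pi * B' t by rewrite /B' mulrC divfK.
have -> : A' t = a - k * A t by rewrite /a; ring.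
have -> : B' t = b - k * B t by rewrite /b; ring.
rewrite -subr_ge0 => H; rewrite -subr_ge0.
apply: le_trans H _; rewrite le_eqVlt; apply/orP; left; apply/eqP.
by ring.
Qed.

(* The equatorial values, to be subtracted from the first harmonics. *)
Let bA := A 0. Let bB := B 0.

Let flux t := cos t * V t + 2 * (sin t * (P t - pi * (A t ^+ 2 + B t ^+ 2)))
  - pi * (harmonic_flux A bA t + harmonic_flux B bB t).

Let flux' t := cos t * (K t + N t) - sin t * V t
  + 2 * (cos t * (P t - pi * (A t ^+ 2 + B t ^+ 2))
         + sin t * (2 * V t - 2 * pi * (A t * A' t + B t * B' t)))
  - pi * (harmonic_flux' A A' bA t + harmonic_flux' B B' bB t).

Let DA : has_derivative A A'.
Proof. exact/derive_fourier/continuous_cos. Qed.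

Let DB : has_derivative B B'.
Proof. exact/derive_fourier/continuous_sin. Qed.

Let is_derive_flux t : sin t != 0 -> is_derive t (1:R) flux (flux' t).
Proof.
move=> s0.
have DfA := is_derive_harmonic_flux bA DA s0.
have DfB := is_derive_harmonic_flux bB DB s0.
have DP := derive_sqr_mean; have DV := derive_sqr_mean2.
rewrite /flux /flux'; isd; ring.
Qed.

Let flux_continuous0 : {for 0, continuous flux}.
Proof.
have cP := is_derive_continuous derive_sqr_mean.
have cV := is_derive_continuous derive_sqr_mean2.
have cA := is_derive_continuous DA; have cB := is_derive_continuous DB.
have c1 : continuous (fun t => cos t * V t
    + 2 * (sin t * (P t - pi * (A t ^+ 2 + B t ^+ 2)))) by cont.
rewrite /continuous_at /flux; apply: cvgB; first exact: c1.
apply: cvgM; first exact: cvg_cst.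
by apply: cvgD; exact: harmonic_flux_continuous0.
Qed.

Let flux_pole t : cos t = 0 -> flux t = 0.
Proof.
move=> c0.
have h0 p : h p t = 0.
  rewrite (chart_pole h p c0); have := mean0 t.
  have -> : (fun p => h p t) = fun=> h 0 t.
    by apply/funext => x; rewrite (chart_pole h x c0).
  rewrite circ_cst => /eqP; rewrite mulf_eq0 mulf_eq0 pnatr_eq0 /=.
  by rewrite (negPf pi_neq0) => /eqP.
have zero (f : R -> R) : (forall p, f p = 0) -> circ f = 0.
  move=> f0; have -> : f = fun=> 0 by apply/funext.
  by rewrite circ_cst mulr0.
have A0 : A t = 0 by rewrite /A zero ?mul0r // => p; rewrite h0 mul0r.
have B0 : B t = 0 by rewrite /B zero ?mul0r // => p; rewrite h0 mul0r.
have P0 : P t = 0 by rewrite /P zero // => p; rewrite h0 expr0n.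
by rewrite /flux !harmonic_flux_pole // A0 B0 P0 c0; ring.
Qed.

Let energy t := cos t * circ (fun p => h p t * ch_lap h p t + 6 * h p t ^+ 2).

Let c_energy : continuous energy.
Proof.
have c : continuous (fun t => circ (fun p => h p t * ch_lap h p t + 6 * h p t ^+ 2)).
  apply: (circ_continuous (g := fun p t => h p t * ch_lap h p t + 6 * h p t ^+ 2)).
  by cont.
by rewrite /energy; cont.
Qed.

Let momA t := cos t ^+ 2 * circ (fun p => h p t * cos p).
Let momB t := cos t ^+ 2 * circ (fun p => h p t * sin p).

(** The square completed in [latitude_energy] is that of the ground state
    [cos ^+ 2] of the second harmonics, whence [k = 2 * tan t]; the first harmonics
    are estimated separately by [harmonic_flux_le]. *)
Lemma energy_le_flux t : 0 < cos t -> sin t != 0 ->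
  energy t <= flux' t + 8 * (bA * momA t + bB * momB t).
Proof.
move=> c0 s0; have cn0 := lt0r_neq0 c0.
have HA := harmonic_flux_le A A' bA c0 s0.
have HB := harmonic_flux_le B B' bB c0 s0.
have HK := latitude_energy t (2 * sin t / cos t).
have HW := longitude_energy t.
have EA : momA t = pi * (cos t ^+ 2 * A t).
  by rewrite /momA -(divfK pi_neq0 (circ _)) -/(A t); ring.
have EB : momB t = pi * (cos t ^+ 2 * B t).
  by rewrite /momB -(divfK pi_neq0 (circ _)) -/(B t); ring.
rewrite /energy circ_lap // /flux' EA EB /tan.
have := cos2Dsin2 t; have := pi_gt0 R.
move: (harmonic_flux' A A' bA t) (harmonic_flux' B B' bB t) HA HB HK HW => fA fB.
move: (cos t) (sin t) (P t) (V t) (K t) (N t) (W t) (A t) (A' t) (B t) (B' t)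
  c0 s0 cn0.
move: (pi : R) bA bB => w b c C S p v k n e a a' d d' C0 S0 Cn0 HA HB HK HW w0 CS.
have SE : S ^+ 2 = 1 - C ^+ 2 by rewrite -CS; ring.
have HK' : w * (C * a' ^+ 2 + 4 * S * a * a' + 4 * S ^+ 2 / C * a ^+ 2)
    + w * (C * d' ^+ 2 + 4 * S * d * d' + 4 * S ^+ 2 / C * d ^+ 2)
    <= C * k + 4 * S * v + 4 * S ^+ 2 / C * p.
  rewrite -subr_ge0 in HK; rewrite -subr_ge0; have := mulr_ge0 (ltW C0) HK.
  by congr (0 <= _); field; exact: Cn0.
have HW' : (4 * p - 3 * w * (a ^+ 2 + d ^+ 2)) / C <= e / C.
  by rewrite ler_pM2r // invr_gt0.
have -> : C * (n - S / C * v - e / C ^+ 2 + 6 * p) =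
    C * n - S * v - e / C + 6 * C * p by field.
have HA' : w * fA <= w * (C * a' ^+ 2 + a ^+ 2 / C - 6 * C * a ^+ 2 + 8 * b * (C ^+ 2 * a)).
  by rewrite ler_pM2l.
have HB' : w * fB <= w * (C * d' ^+ 2 + d ^+ 2 / C - 6 * C * d ^+ 2 + 8 * c * (C ^+ 2 * d)).
  by rewrite ler_pM2l.
have SC : S ^+ 2 / C = C^-1 - C by rewrite SE; field.
have -> : C * (k + n) - S * v = C * k + C * n - S * v by ring.
move: HK' HW' HA' HB'; rewrite -!(mulrA 4 (S ^+ 2)) SC.
lra.
Qed.

Let sin_neq0 (t : R) : - (pi / 2) <= t <= pi / 2 -> t != 0 -> sin t != 0.
Proof.
have pi0 : 0 < (pi : R) := pi_gt0 R.
move=> /andP[t1 t2] t0; have [tn|tp|] := ltgtP t 0; last first.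
- by move=> E; rewrite E eqxx in t0.
- by rewrite gt_eqF // sin_gt0_pi //; apply/andP; split; lra.
- rewrite -oppr_eq0 -sinN gt_eqF // sin_gt0_pi //.
  by apply/andP; split; lra.
Qed.

Hypothesis moment1 : lat momA = 0.
Hypothesis moment2 : lat momB = 0.

(** The flux is differentiable off the equator, continuous across it and zero at
    the poles: [energy_le_flux] is integrated over both hemispheres, and the
    moment terms drop out. *)
Lemma spectral_gap : lat energy <= 0.
Proof.
have pi0 : 0 < (pi : R) := pi_gt0 R.
have cA : continuous momA.
  have c : continuous (fun t => circ (fun p => h p t * cos p)).
    by apply: (circ_continuous (g := fun p t => h p t * cos p)); cont.
  by rewrite /momA; cont.
have cB : continuous momB.
  have c : continuous (fun t => circ (fun p => h p t * sin p)).
    by apply: (circ_continuous (g := fun p t => h p t * sin p)); cont.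
  by rewrite /momB; cont.
pose g t := 8 * (bA * momA t + bB * momB t) - energy t.
have cg : continuous g by rewrite /g; cont.
have Eg : lat g = - lat energy.
  rewrite /lat /g intg_add ?lat_le //; [|by cont..].
  rewrite intg_opp ?lat_le // intg_scale ?lat_le //; last by cont.
  rewrite intg_add ?lat_le //; [|by cont..].
  rewrite !intg_scale ?lat_le // -!/(lat _) moment1 moment2; ring.
have [G DG GE] := intg_primitive cg (lat_le R).
rewrite -/(lat g) Eg in GE.
pose Xi t := flux t + G t.
have DXi t : sin t != 0 -> is_derive t (1:R) Xi (flux' t + g t).
  by move=> s0; have Df := is_derive_flux s0; rewrite /Xi; isd.
have cXi t : - (pi / 2) <= t <= pi / 2 -> {for t, continuous Xi}.
  move=> tpi; have [->|t0] := eqVneq t 0.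
    apply: cvgD; first exact: flux_continuous0.
    exact: (is_derive_continuous DG).
  apply/differentiable_continuous/derivable1_diffP.
  by case: (DXi _ (sin_neq0 tpi t0)).
have piece x y : x <= y -> - (pi / 2) <= x -> y <= pi / 2 ->
    (forall t : R, x < t < y -> t != 0) -> Xi x <= Xi y.
  move=> xy xl yu n0; apply: (derive_ge0_le xy (dF := fun t => flux' t + g t)).
  - move=> t /[dup] xty /andP[xt ty]; apply: DXi; apply: sin_neq0 (n0 _ xty).
    by apply/andP; split; lra.
  - move=> t /[dup] xty /andP[xt ty].
    have ct : 0 < cos t by apply: cos_gt0_pihalf; apply/andP; split; lra.
    have st : sin t != 0.
      by apply: sin_neq0 (n0 _ xty); apply/andP; split; lra.
    by have := energy_le_flux ct st; rewrite /g; lra.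
  - apply: continuous_in_subspaceT => t; rewrite inE /= in_itv /= => /andP[xt ty].
    by apply: cXi; apply/andP; split; lra.
have left : Xi (- (pi / 2)) <= Xi 0.
  by apply: piece => [|||t /andP[_ t0]]; rewrite ?lt_eqF //; lra.
have right : Xi 0 <= Xi (pi / 2).
  by apply: piece => [|||t /andP[t0 _]]; rewrite ?gt_eqF //; lra.
have := le_trans left right.
rewrite /Xi !flux_pole ?cosN ?cos_pihalf // !add0r.
by move: GE; lra.
Qed.

(** The hypothesis makes the energy density nonnegative, and positive where [h]
    does not vanish, whereas its integral is nonpositive by the spectral gap. *)
Lemma chart_rigidity :
  (forall p t : R, - (pi / 2) < t < pi / 2 -> h p t != 0 ->
     - 6 * h p t ^+ 2 < h p t * ch_lap h p t) ->
  forall p t : R, 0 < p < 2 * pi -> - (pi / 2) < t < pi / 2 -> h p t = 0.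
Proof.
move=> H.
pose f p t := h p t * ch_lap h p t + 6 * h p t ^+ 2.
have f_ge0 (p t : R) : - (pi / 2) < t < pi / 2 -> 0 <= f p t.
  move=> tpi; rewrite /f; have [->|hn0] := eqVneq (h p t) 0.
    by rewrite expr0n /= !mul0r mulr0 addr0.
  by have := H p t tpi hn0; lra.
have energy_ge0 (t : R) : - (pi / 2) <= t <= pi / 2 -> 0 <= energy t.
  move=> tcl; rewrite /energy; have [->|ct] := eqVneq (cos t) 0.
    by rewrite mul0r.
  have tpi := latitude_interior tcl ct.
  rewrite mulr_ge0 ?(ltW (cos_gt0_pihalf tpi)) //.
  by apply: circ_ge0 => p; exact: f_ge0.
have E0 : forall t : R, - (pi / 2) < t < pi / 2 -> energy t = 0.
  apply: (intg_eq0 (lat_le R) c_energy energy_ge0).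
  by apply/eqP; rewrite eq_le spectral_gap /=; exact: intg_ge0.
move=> p t p2 tpi; have := E0 t tpi; rewrite /energy => /eqP.
rewrite mulf_eq0 gt_eqF ?cos_gt0_pihalf //= => /eqP C0.
have ft0 := intg_eq0 (two_pi_ge0 R) _ _ C0 p2.
have : f p t = 0.
  by apply: ft0; [rewrite /f; cont|move=> x _; exact: f_ge0].
apply: contra_eq => hn0; rewrite gt_eqF //.
by have := H p t tpi hn0; rewrite /f; lra.
Qed.

End Gap.

(** * Moments, and rigidity of solutions with vanishing moments *)

Section Moments.
Variable R : realType.
Implicit Types (u : R -> R -> R) (h : chart R).

Definition moment1 u := lat (fun t => cos t ^+ 2 * circ (fun p => u p t * cos p)).
Definition moment2 u := lat (fun t => cos t ^+ 2 * circ (fun p => u p t * sin p)).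

Lemma has_derivative_shift (F f : R -> R) (s : R) : has_derivative F f ->
  has_derivative (fun x => F (x + s)) (fun x => f (x + s)).
Proof. by move=> D x; isd; ring. Qed.

Program Definition chart_shift h (s : R) : chart R := {|
  ch := fun p t => h (p + s) t;
  ch_t := fun p t => ch_t h (p + s) t; ch_p := fun p t => ch_p h (p + s) t;
  ch_tt := fun p t => ch_tt h (p + s) t; ch_tp := fun p t => ch_tp h (p + s) t;
  ch_pp := fun p t => ch_pp h (p + s) t; ch_q := fun p t => ch_q h (p + s) t;
  ch_lap := fun p t => ch_lap h (p + s) t |}.
Next Obligation. by move=> h s; have c := @ch_cont R h; cont. Qed.
Next Obligation. by move=> h s; have c := @ch_t_cont R h; cont. Qed.
Next Obligation. by move=> h s; have c := @ch_p_cont R h; cont. Qed.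
Next Obligation. by move=> h s; have c := @ch_tt_cont R h; cont. Qed.
Next Obligation. by move=> h s; have c := @ch_tp_cont R h; cont. Qed.
Next Obligation. by move=> h s; have c := @ch_pp_cont R h; cont. Qed.
Next Obligation. by move=> h s; have c := @ch_q_cont R h; cont. Qed.
Next Obligation. by move=> h s; have c := @ch_lap_cont R h; cont. Qed.
Next Obligation. by move=> h s p; exact: ch_dt. Qed.
Next Obligation. move=> h s t; exact: (has_derivative_shift s (ch_dp h t)). Qed.
Next Obligation. by move=> h s p; exact: ch_dtt. Qed.
Next Obligation. move=> h s t; exact: (has_derivative_shift s (ch_dtp h t)). Qed.
Next Obligation. by move=> h s p; exact: ch_dpt. Qed.
Next Obligation. move=> h s t; exact: (has_derivative_shift s (ch_dpp h t)). Qed.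
Next Obligation. by move=> h s p t; exact: ch_qE. Qed.
Next Obligation. by move=> h s p t /=; rewrite addrAC ch_per. Qed.
Next Obligation. by move=> h s p t /=; rewrite addrAC ch_t_per. Qed.
Next Obligation. by move=> h s p t /=; rewrite addrAC ch_p_per. Qed.
Next Obligation. by move=> h s p t ct /=; exact: ch_lapE. Qed.

Program Definition chart_sub h (k : chart R) : chart R := {|
  ch := fun p t => h p t - k p t;
  ch_t := fun p t => ch_t h p t - ch_t k p t;
  ch_p := fun p t => ch_p h p t - ch_p k p t;
  ch_tt := fun p t => ch_tt h p t - ch_tt k p t;
  ch_tp := fun p t => ch_tp h p t - ch_tp k p t;
  ch_pp := fun p t => ch_pp h p t - ch_pp k p t;
  ch_q := fun p t => ch_q h p t - ch_q k p t;
  ch_lap := fun p t => ch_lap h p t - ch_lap k p t |}.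
Next Obligation. by move=> h k; have c := @ch_cont R h; have d := @ch_cont R k; cont. Qed.
Next Obligation. by move=> h k; have c := @ch_t_cont R h; have d := @ch_t_cont R k; cont. Qed.
Next Obligation. by move=> h k; have c := @ch_p_cont R h; have d := @ch_p_cont R k; cont. Qed.
Next Obligation. by move=> h k; have c := @ch_tt_cont R h; have d := @ch_tt_cont R k; cont. Qed.
Next Obligation. by move=> h k; have c := @ch_tp_cont R h; have d := @ch_tp_cont R k; cont. Qed.
Next Obligation. by move=> h k; have c := @ch_pp_cont R h; have d := @ch_pp_cont R k; cont. Qed.
Next Obligation. by move=> h k; have c := @ch_q_cont R h; have d := @ch_q_cont R k; cont. Qed.
Next Obligation. by move=> h k; have c := @ch_lap_cont R h; have d := @ch_lap_cont R k; cont. Qed.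
Next Obligation. by move=> h k p t; have D := ch_dt h p; have D' := ch_dt k p; isd. Qed.
Next Obligation. by move=> h k t p; apply: is_derive1_add; [exact: ch_dp|exact/is_derive1_opp/ch_dp]. Qed.
Next Obligation. by move=> h k p t; have D := ch_dtt h p; have D' := ch_dtt k p; isd. Qed.
Next Obligation. by move=> h k t p; apply: is_derive1_add; [exact: ch_dtp|exact/is_derive1_opp/ch_dtp]. Qed.
Next Obligation. by move=> h k p t; have D := ch_dpt h p; have D' := ch_dpt k p; isd. Qed.
Next Obligation. by move=> h k t p; apply: is_derive1_add; [exact: ch_dpp|exact/is_derive1_opp/ch_dpp]. Qed.
Next Obligation. by move=> h k p t /=; rewrite !ch_qE; ring. Qed.
Next Obligation. by move=> h k p t /=; rewrite !ch_per. Qed.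
Next Obligation. by move=> h k p t /=; rewrite !ch_t_per. Qed.
Next Obligation. by move=> h k p t /=; rewrite !ch_p_per. Qed.
Next Obligation. by move=> h k p t ct /=; rewrite !ch_lapE //; ring. Qed.

Lemma circ_fourier_shift (f : R -> R) (s : R) : continuous f ->
  (forall x, f (x + 2 * pi) = f x) ->
  circ (fun p => f (p + s) * cos p) =
    cos s * circ (fun p => f p * cos p) + sin s * circ (fun p => f p * sin p) /\
  circ (fun p => f (p + s) * sin p) =
    cos s * circ (fun p => f p * sin p) - sin s * circ (fun p => f p * cos p).
Proof.
move=> cf per; split.
- pose g x := f x * cos (x - s).
  have cg : continuous g by rewrite /g; cont.
  have gper x : g (x + 2 * pi) = g x by rewrite /g per addrAC cosDtwopi.
  have := circ_shift s cg gper; rewrite /g.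
  have -> : (fun x => f (x + s) * cos (x + s - s)) = fun p => f (p + s) * cos p.
    by apply/funext => x; rewrite addrK.
  move=> ->.
  rewrite -!circ_scale -?circ_add; [|by cont..].
  by congr circ; apply/funext => x; rewrite cosB; ring.
- pose g x := f x * sin (x - s).
  have cg : continuous g by rewrite /g; cont.
  have gper x : g (x + 2 * pi) = g x by rewrite /g per addrAC sinDtwopi.
  have := circ_shift s cg gper; rewrite /g.
  have -> : (fun x => f (x + s) * sin (x + s - s)) = fun p => f (p + s) * sin p.
    by apply/funext => x; rewrite addrK.
  move=> ->.
  rewrite -!circ_scale -?circ_opp -?circ_add; [|by cont..].
  by congr circ; apply/funext => x; rewrite sinB; ring.
Qed.

Lemma circ_moment_continuous u (f : R -> R) : continuous2 u -> continuous f ->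
  continuous (fun t => circ (fun p => u p t * f p)).
Proof.
by move=> cu cf; apply: (circ_continuous (g := fun p t => u p t * f p)); cont.
Qed.

Lemma moment_shift u (s : R) : continuous2 u ->
  (forall p t, u (p + 2 * pi) t = u p t) ->
  moment1 (fun p t => u (p + s) t) = cos s * moment1 u + sin s * moment2 u /\
  moment2 (fun p t => u (p + s) t) = cos s * moment2 u - sin s * moment1 u.
Proof.
move=> cu per.
have cut t : continuous (u ^~ t) by cont.
have cc := circ_moment_continuous cu (@continuous_cos R).
have cs := circ_moment_continuous cu (@continuous_sin R).
rewrite /moment1 /moment2 /lat; split.
- rewrite -!intg_scale ?lat_le //; [|by cont..].
  rewrite -intg_add ?lat_le //; [|by cont..].
  congr intg; apply/funext => t.
  by rewrite (circ_fourier_shift s (cut t) (fun x => per x t)).1; ring.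
- rewrite -!intg_scale ?lat_le //; [|by cont..].
  rewrite -intg_opp ?lat_le //; [|by cont..].
  rewrite -intg_add ?lat_le //; [|by cont..].
  congr intg; apply/funext => t.
  by rewrite (circ_fourier_shift s (cut t) (fun x => per x t)).2; ring.
Qed.

Lemma moment_sub u v : continuous2 u -> continuous2 v ->
  moment1 (fun p t => u p t - v p t) = moment1 u - moment1 v /\
  moment2 (fun p t => u p t - v p t) = moment2 u - moment2 v.
Proof.
move=> cu cv.
have cut t : continuous (u ^~ t) by cont.
have cvt t : continuous (v ^~ t) by cont.
have cuc := circ_moment_continuous cu (@continuous_cos R).
have cus := circ_moment_continuous cu (@continuous_sin R).
have cvc := circ_moment_continuous cv (@continuous_cos R).
have cvs := circ_moment_continuous cv (@continuous_sin R).
rewrite /moment1 /moment2 /lat; split.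
- rewrite -intg_opp ?lat_le //; [|by cont..].
  rewrite -intg_add ?lat_le //; [|by cont..].
  congr intg; apply/funext => t; rewrite -mulrBr -circ_opp; last by cont.
  rewrite -circ_add; [|by cont..].
  by congr (_ * circ _); apply/funext => p; ring.
- rewrite -intg_opp ?lat_le //; [|by cont..].
  rewrite -intg_add ?lat_le //; [|by cont..].
  congr intg; apply/funext => t; rewrite -mulrBr -circ_opp; last by cont.
  rewrite -circ_add; [|by cont..].
  by congr (_ * circ _); apply/funext => p; ring.
Qed.

(** The difference [w] of [h] with a rotated copy of it has zonal mean zero and,
    since the moments of [h] vanish, no first moments; by the mean value theorem
    [Lap w] is [w] times a value of [F'], which is larger than [- 6]. *)
Lemma zonal_of_moments h (omega : R) (F : R -> R) :
  (forall x, derivable F x 1) -> (forall x, - 6 < derive1 F x) ->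
  (forall p t : R, - (pi / 2) < t < pi / 2 ->
     ch_lap h p t = F (h p t) - 2 * omega * sin t) ->
  moment1 h = 0 -> moment2 h = 0 ->
  forall p t : R, - (pi / 2) <= t <= pi / 2 -> h p t = h 0 t.
Proof.
move=> dF F6 pde m1 m2.
have pi0 : 0 < (pi : R) := pi_gt0 R.
have pi2 : 0 < (pi : R) < 2 * pi by apply/andP; split; lra.
have inner p t : - (pi / 2) < t < pi / 2 -> h p t = h pi t.
  move=> tpi; pose s := p - pi.
  pose w := chart_sub (chart_shift h s) h.
  have ch_ := @ch_cont R h.
  suff : w pi t = 0.
    by rewrite /w /= /s addrCA subrr addr0 => /eqP; rewrite subr_eq0 => /eqP.
  have cs : continuous2 (fun p t => h (p + s) t) by cont.
  have [S1 S2] := moment_shift s ch_ (@ch_per R h).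
  have [M1 M2] := moment_sub cs ch_.
  apply: (chart_rigidity (h := w)).
  - move=> t'; rewrite /w /=.
    rewrite circ_add; [|by cont..].
    rewrite circ_opp; last by cont.
    rewrite (circ_shift s (g := h ^~ t')) ?subrr //; first by cont.
    by move=> x; exact: ch_per.
  - by move: M1; rewrite S1 m1 m2 => E; rewrite -[LHS]/(moment1 _) E; ring.
  - by move: M2; rewrite S2 m1 m2 => E; rewrite -[LHS]/(moment2 _) E; ring.
  - move=> p' t' tpi'; rewrite /w /= !pde //.
    move: (h (p' + s) t') (h p' t') => a b ab.
    have cF x : {for x, continuous F}.
      exact/differentiable_continuous/derivable1_diffP.
    have DF x : is_derive x (1:R) F (derive1 F x).
      by rewrite derive1E; exact/derivableP.
    have [c E] : exists c, F a - F b = derive1 F c * (a - b).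
      have [ltab|ltba|E] := ltgtP a b; last by rewrite E subrr eqxx in ab.
      + have [|c _ E] := MVT ltab (fun x _ => DF x).
          exact: continuous_subspaceT.
        exists c; rewrite -opprB E -(opprB b) mulrN; reflexivity.
      + have [|c _ E] := MVT ltba (fun x _ => DF x).
          exact: continuous_subspaceT.
        by exists c.
    have -> : F a - 2 * omega * sin t' - (F b - 2 * omega * sin t') = F a - F b.
      by ring.
    rewrite E (mulrCA (a - b)) ltr_pM2r //.
    by rewrite lt_def sqr_ge0 andbT sqrf_eq0.
  - exact: pi2.
  - exact: tpi.
move=> p t tcl; have [ct|ct] := eqVneq (cos t) 0.
  exact: chart_pole.
have tpi := latitude_interior tcl ct.
by rewrite (inner p) // (inner 0).
Qed.

End Moments.

(** * Vanishing of the moments on a rotating sphere *)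

Section Pohozaev.
Variable R : realType.
Implicit Types (h : chart R) (omega : R) (F : R -> R).

Section Flux.
Variables (h : chart R) (omega : R) (F FF : R -> R).
Hypothesis cF : continuous F.
Hypothesis DFF : has_derivative FF F.
Hypothesis pde : forall p t : R, - (pi / 2) < t < pi / 2 ->
  ch_lap h p t = F (h p t) - 2 * omega * sin t.

Let ht := ch_t h. Let hp := ch_p h. Let q := ch_q h.
Let c_h : continuous2 h := @ch_cont R h.
Let c_ht : continuous2 ht := @ch_t_cont R h.
Let c_hp : continuous2 hp := @ch_p_cont R h.
Let c_htt : continuous2 (ch_tt h) := @ch_tt_cont R h.
Let c_htp : continuous2 (ch_tp h) := @ch_tp_cont R h.
Let c_hpp : continuous2 (ch_pp h) := @ch_pp_cont R h.
Let c_q : continuous2 q := @ch_q_cont R h.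
Let cFF : continuous FF := is_derive_continuous DFF.

(* The total flux through a parallel is split into the part [g], regular up to
   the poles, and the part [S / cos], which is [cos] times a continuous function
   since [ch_p = cos * ch_q]. *)
Let g p t := 2^-1 * sin p * cos t * ht p t ^+ 2 - sin t * cos p * (hp p t * ht p t)
  - cos t * sin p * FF (h p t) + 2 * omega * (cos t * sin t * sin p * h p t).

Let dg p t := 2^-1 * sin p * (- sin t * ht p t ^+ 2 + 2 * cos t * (ht p t * ch_tt h p t))
  - cos t * cos p * (hp p t * ht p t)
  - sin t * cos p * (ch_tp h p t * ht p t + hp p t * ch_tt h p t)
  + sin t * sin p * FF (h p t) - cos t * sin p * (F (h p t) * ht p t)
  + 2 * omega * ((cos t ^+ 2 - sin t ^+ 2) * sin p * h p t
                 + cos t * sin t * sin p * ht p t).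

Let S t := circ (fun p => sin p * hp p t ^+ 2).

Let flux t := circ (fun p => g p t) - 2^-1 * (S t / cos t).

Let is_derive_g : has_derivative (fun t => circ (fun p => g p t))
                                 (fun t => circ (fun p => dg p t)).
Proof.
apply: (is_derive_circ (g := g) (dg := dg)); [by rewrite /g; cont|by rewrite /dg; cont|].
move=> p t; have D1 := ch_dt h p; have D2 := ch_dtt h p; have D3 := ch_dpt h p.
by rewrite /g /dg /ht /hp; isd; field.
Qed.

Let is_derive_S : has_derivative S
  (fun t => circ (fun p => 2 * sin p * (hp p t * ch_tp h p t))).
Proof.
apply: (is_derive_circ (g := fun p t => sin p * hp p t ^+ 2)
  (dg := fun p t => 2 * sin p * (hp p t * ch_tp h p t))); [by cont|by cont|].
by move=> p t; have D3 := ch_dpt h p; rewrite /hp; isd; ring.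
Qed.

Let flux_continuous : continuous flux.
Proof.
have -> : flux = fun t => circ (fun p => g p t)
    - 2^-1 * (cos t * circ (fun p => sin p * q p t ^+ 2)).
  apply/funext => t; rewrite /flux; congr (_ - _ * _).
  have -> : S t = cos t ^+ 2 * circ (fun p => sin p * q p t ^+ 2).
    rewrite /S -circ_scale; last by cont.
    by congr circ; apply/funext => p; rewrite /hp ch_qE -/q; ring.
  have [->|ct] := eqVneq (cos t) 0; first by rewrite invr0 mulr0 mul0r.
  by field.
have c1 := is_derive_continuous is_derive_g.
have c2 : continuous (fun t => circ (fun p => sin p * q p t ^+ 2)).
  by apply: (circ_continuous (g := fun p t => sin p * q p t ^+ 2)); cont.
by cont.
Qed.

Let flux_pole t : cos t = 0 -> flux t = 0.
Proof.
move=> ct; rewrite /flux ct invr0 !mulr0 subr0.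
have -> : (fun p => g p t) = fun=> 0.
  by apply/funext => p; rewrite /g /hp ch_qE ct; ring.
by rewrite circ_cst mulr0.
Qed.

(** The conservation law attached to the rotations about the first axis: with
    [L u = sin p * u_t - tan t * cos p * u_p] the corresponding derivative,
    the product of [cos t * L h] with the equation is a total divergence, up to
    the term of the Coriolis force.  Here the longitudinal part of that
    divergence integrates to zero over each parallel. *)
Let is_derive_flux t : - (pi / 2) < t < pi / 2 -> is_derive t (1:R) flux
  (2 * omega * (cos t ^+ 2 * circ (fun p => h p t * sin p))).
Proof.
move=> tpi; have ct : cos t != 0 by rewrite gt_eqF // cos_gt0_pihalf.
(* [X] is the longitudinal component of the divergence. *)
pose X p := sin p * (ht p t * hp p t) / cos t
  + 2^-1 * sin t * cos p * (ht p t ^+ 2 - hp p t ^+ 2 / cos t ^+ 2)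
  + sin t * cos p * FF (h p t) - 2 * omega * (sin t ^+ 2 * cos p * h p t).
pose X' p := (cos p * (ht p t * hp p t)
    + sin p * (ch_tp h p t * hp p t + ht p t * ch_pp h p t)) / cos t
  + 2^-1 * sin t * (- sin p * (ht p t ^+ 2 - hp p t ^+ 2 / cos t ^+ 2)
    + cos p * (2 * (ht p t * ch_tp h p t)
               - 2 * (hp p t * ch_pp h p t) / cos t ^+ 2))
  + sin t * (- sin p * FF (h p t) + cos p * (F (h p t) * hp p t))
  - 2 * omega * (sin t ^+ 2 * (- sin p * h p t + cos p * hp p t)).
have cX' : continuous X' by rewrite /X'; cont.
have X0 : circ X' = 0.
  apply: (circ_derivative (G := X) cX').
  - move=> p; have D1 := ch_dp h t; have D2 := ch_dtp h t; have D3 := ch_dpp h t.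
    have D4 : is_derive p (1:R) (fun p => FF (h p t)) (F (h p t) * hp p t).
      exact: (is_derive1_compo (f := FF) (D1 p) (DFF _)).
    by rewrite /X /X' /ht /hp; isd; field.
  - have := ch_per h 0 t; have := ch_p_per h 0 t; have := ch_t_per h 0 t.
    rewrite !add0r /X /ht /hp => -> -> ->.
    by rewrite sin_2pi cos_2pi sin0 cos0.
have DS := is_derive_S t; have Dg := is_derive_g t.
rewrite /flux; isd; first exact: ct.
have cZ : continuous (fun p => 2 * sin p * (hp p t * ch_tp h p t)) by cont.
have cS : continuous (fun p => sin p * hp p t ^+ 2) by cont.
have cd : continuous (fun p => dg p t) by rewrite /dg; cont.
transitivity (circ (fun p => dg p t)
  + (- (2^-1 / cos t) * circ (fun p => 2 * sin p * (hp p t * ch_tp h p t))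
  + (- (2^-1 * sin t / cos t ^+ 2) * S t + circ X'))); first by rewrite X0; ring.
rewrite /S -!circ_scale; [|by cont..].
do 3 (rewrite -circ_add; [|by cont..]).
congr circ; apply/funext => p.
have := pde p tpi; rewrite ch_lapE // -/ht => E.
have Ett : ch_tt h p t = F (h p t) - 2 * omega * sin t + tan t * ht p t
    - (cos t ^+ 2)^-1 * ch_pp h p t by rewrite -E; ring.
rewrite /dg /X' Ett /tan.
have -> : cos p * (ht p t * hp p t) =
    cos p * (ht p t * hp p t) * (cos t ^+ 2 + sin t ^+ 2).
  by rewrite cos2Dsin2 mulr1.
by field.
Qed.

(** The flux vanishes at both poles. *)
Lemma pohozaev_identity : 2 * omega * moment2 h = 0.
Proof.
have cm : continuous (fun t => cos t ^+ 2 * circ (fun p => h p t * sin p)).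
  by have c := circ_moment_continuous c_h (@continuous_sin R); cont.
have [G DG E] := intg_primitive cm (lat_le R).
have cG := is_derive_continuous DG.
pose D (e t : R) := e * (flux t - 2 * omega * G t).
have DD e t : - (pi / 2) < t < pi / 2 -> is_derive t (1:R) (D e) 0.
  by move=> tpi; have Df := is_derive_flux tpi; rewrite /D; isd; ring.
have mono e : D e (- (pi / 2)) <= D e (pi / 2).
  apply: (derive_ge0_le (lat_le R) (DD e)) => //.
  by apply: continuous_subspaceT; rewrite /D; cont.
have := mono 1; have := mono (-1).
rewrite /D !flux_pole ?cosN ?cos_pihalf // /moment2 /lat E.
move: (G _) (G _) => a b; lra.
Qed.

End Flux.

(** The first moment is, up to sign, the second moment of the solution turned by
    a quarter of a circle, which solves the same equation. *)
Lemma moments_of_rotation h omega F : omega != 0 -> continuous F ->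
  (forall p t : R, - (pi / 2) < t < pi / 2 ->
     ch_lap h p t = F (h p t) - 2 * omega * sin t) ->
  moment1 h = 0 /\ moment2 h = 0.
Proof.
move=> omega0 cF pde; have [FF DFF] := primitive_exists cF.
have cancel (x : R) : 2 * omega * x = 0 -> x = 0.
  by move=> /eqP; rewrite !mulf_eq0 pnatr_eq0 (negPf omega0) => /eqP.
split; last exact: (cancel _ (pohozaev_identity cF DFF pde)).
have pde' (p t : R) : - (pi / 2) < t < pi / 2 ->
    ch_lap (chart_shift h (pi / 2)) p t =
    F (chart_shift h (pi / 2) p t) - 2 * omega * sin t.
  exact: pde.
have := cancel _ (pohozaev_identity cF DFF pde').
have [_] := moment_shift (pi / 2) (@ch_cont R h) (@ch_per R h).
rewrite cos_pihalf sin_pihalf mul0r mul1r sub0r -[moment2 _]/(moment2 (chart_shift h (pi / 2))) => -> /eqP.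
by rewrite oppr_eq0 => /eqP.
Qed.

End Pohozaev.

(** * Calculus in the ambient space *)

Section Ambient.
Variable R : realType.
Implicit Types (U : set 'cV[R]_3) (f a : 'cV[R]_3 -> R) (X Y : 'cV[R]_3).

Lemma is_derive1_sum n (f : 'I_n -> R -> R) (df : 'I_n -> R) (x : R) :
  (forall i, is_derive x (1:R) (f i) (df i)) ->
  is_derive x (1:R) (fun y => \sum_(i < n) f i y) (\sum_(i < n) df i).
Proof.
move=> D; have -> : (fun y => \sum_(i < n) f i y) = \sum_(i < n) f i.
  by apply/funext => y; rewrite fct_sumE.
exact: is_derive_sum.
Qed.

Lemma cvg_sum (T : Type) (F : set_system T) (FF : Filter F) n
    (f : 'I_n -> T -> R) (l : 'I_n -> R) :
  (forall i, f i x @[x --> F] --> l i) ->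
  (\sum_(i < n) f i x) @[x --> F] --> \sum_(i < n) l i.
Proof.
by move=> fl; apply: cvg_big => [|i _]; [exact: add_continuous|exact: fl].
Qed.

Lemma continuous_sum (T : topologicalType) n (f : 'I_n -> T -> R) :
  (forall i, continuous (f i)) -> continuous (fun y => \sum_(i < n) f i y).
Proof.
by move=> cf x; apply: cvg_sum => i; exact: cf.
Qed.

Definition mix (k : nat) X Y : 'cV[R]_3 :=
  \col_(i < 3) (if (i < k)%N then Y i 0 else X i 0).

Lemma mix0 X Y : mix 0 X Y = X.
Proof. by apply/colP => i; rewrite mxE. Qed.

Lemma mix3 X Y : mix 3 X Y = Y.
Proof. by apply/colP => i; rewrite mxE ltn_ord. Qed.

Lemma mixS (i : 'I_3) X Y :
  mix i.+1 X Y = (Y i 0 - X i 0) *: delta_mx i 0 + mix i X Y.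
Proof.
apply/colP => j; rewrite !mxE andbT ltnS leq_eqVlt.
have [->|ji] := eqVneq j i; first by rewrite eqxx ltnn /= mulr1 subrK.
have -> /= : (nat_of_ord j == i) = false by apply/negbTE.
by rewrite mulr0 add0r.
Qed.

(** The increment from [X] to [Y] is decomposed along the path that changes the
    coordinates one after the other; when the [i]-th coordinates agree, the value
    chosen makes the slope converge to the partial derivative. *)
Definition slope f X (i : 'I_3) Y : R :=
  if Y i 0 == X i 0 then partial i f X
  else (f (mix i.+1 X Y) - f (mix i X Y)) / (Y i 0 - X i 0).

Lemma slopeE f X Y :
  f Y = f X + \sum_(i < 3) slope f X i Y * (Y i 0 - X i 0).
Proof.
have E (i : 'I_3) : slope f X i Y * (Y i 0 - X i 0) =
    f (mix i.+1 X Y) - f (mix i X Y).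
  rewrite /slope; case: eqP => [E|/eqP E].
    by rewrite mixS E !subrr scale0r add0r subrr mulr0.
  by rewrite divfK // subr_eq0.
rewrite (eq_bigr _ (fun i _ => E i)) !big_ord_recl big_ord0 /= -{1}(mix3 X Y).
by rewrite -[in f X](mix0 X Y) /bump /=; ring.
Qed.

Lemma is_derive_line U f (i : 'I_3) X (s : R) : C1_on U f ->
  U (s *: delta_mx i 0 + X) ->
  is_derive s (1:R) (fun r : R => f (r *: delta_mx i 0 + X))
    (partial i f (s *: delta_mx i 0 + X)).
Proof.
move=> C1 Us; have [df _] := C1 i _ Us.
have E : (fun h : R => h^-1 *: (((fun r : R => f (r *: delta_mx i 0 + X)) \o shift s)
    (h *: (1:R)) - f (s *: delta_mx i 0 + X))) =
  (fun h : R => h^-1 *: ((f \o shift (s *: delta_mx i 0 + X)) (h *: delta_mx i 0)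
    - f (s *: delta_mx i 0 + X))).
  apply/funext => h /=; congr (_ *: (f _ - _)).
  by rewrite scalerDl addrA [h *: (1:R)]mulr1.
apply: DeriveDef.
- by rewrite /derivable E.
- by rewrite /partial /derive E.
Qed.

(** By the mean value theorem a slope is a value of the partial derivative near
    [X]. *)
Lemma slope_cvg U f X (i : 'I_3) : open U -> C1_on U f -> U X ->
  slope f X i Y @[Y --> X] --> partial i f X.
Proof.
move=> oU C1 UX; have FX : Filter (nbhs X) by exact: nbhs_filter.
apply/(@cvgrPdist_lt _ _ _ (nbhs X) FX) => e e0.
have [_ cp] := C1 i _ UX.
have N1 : \forall Y \near X, U Y /\ `|partial i f X - partial i f Y| < e.
  have UN : nbhs X U by exact: open_nbhs_nbhs.
  have PN : \forall Y \near X, `|partial i f X - partial i f Y| < e.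
    by have /cvgrPdist_lt := cp; apply.
  exact: (@filterI _ (nbhs X) _ _ _ UN PN).
move: N1 => /nbhs_ballP [d /= d0 N1].
near=> Y; rewrite /slope; case: eqP => [_|/eqP YX]; first by rewrite subrr normr0.
have Yd (j : 'I_3) : `|X j 0 - Y j 0| < d.
  have : ball X d Y by near: Y; exact: nbhsx_ballx.
  by case=> _ /(_ j 0).
pose Z := mix i X Y; pose y := Y i 0 - X i 0.
have y0 : y != 0 by rewrite subr_eq0.
have Zd (s : R) : `|s| <= `|y| -> ball X d (s *: delta_mx i 0 + Z).
  move=> sy; split => // j k; rewrite (ord1 k) /ball /= !mxE andbT.
  have [->|ji] := eqVneq j i.
    rewrite ltnn mulr1 opprD addrCA subrr addr0 normrN.
    by apply: le_lt_trans sy _; rewrite /y distrC.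
  rewrite mulr0 add0r; case: ifP => _; first exact: Yd.
  by rewrite subrr normr0.
have line (s : R) : `|s| <= `|y| -> is_derive s (1:R)
    (fun r : R => f (r *: delta_mx i 0 + Z)) (partial i f (s *: delta_mx i 0 + Z)).
  by move=> sy; apply: (is_derive_line C1); exact: (N1 _ (Zd _ sy)).1.
have [s sy E] : exists2 s : R, `|s| <= `|y| &
    f (mix i.+1 X Y) - f Z = partial i f (s *: delta_mx i 0 + Z) * y.
  rewrite mixS -/y -/Z.
  have f0 : f Z = f (0 *: delta_mx i 0 + Z) by rewrite scale0r add0r.
  have [yn|yp|yE] := ltgtP y 0; last by rewrite yE eqxx in y0.
  - have inn (r : R) : r \in `[y, 0]%R -> `|r| <= `|y|.
      by rewrite in_itv /= => /andP[? ?]; rewrite !ler0_norm ?lerN2 // ltW.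
    have [|r|r ry E] := @MVT_segment R (fun r : R => f (r *: delta_mx i 0 + Z))
      (fun s => partial i f (s *: delta_mx i 0 + Z)) y 0 (ltW yn).
    + move=> r; rewrite in_itv /= => /andP[? ?]; apply: line.
      by apply: inn; rewrite in_itv /= !ltW.
    + apply: derivable_within_continuous => r' ry.
      by case: (line r' (inn _ ry)).
    exists r; first exact: inn.
    by rewrite f0; move: E => /=; rewrite sub0r mulrN -opprB => /oppr_inj.
  - have inn (r : R) : r \in `[0, y]%R -> `|r| <= `|y|.
      by rewrite in_itv /= => /andP[? ?]; rewrite !ger0_norm // ltW.
    have [|r|r ry E] := @MVT_segment R (fun r : R => f (r *: delta_mx i 0 + Z))
      (fun s => partial i f (s *: delta_mx i 0 + Z)) 0 y (ltW yp).
    + move=> r; rewrite in_itv /= => /andP[? ?]; apply: line.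
      by apply: inn; rewrite in_itv /= !ltW.
    + apply: derivable_within_continuous => r' ry.
      by case: (line r' (inn _ ry)).
    exists r; first exact: inn.
    by rewrite f0; move: E => /=; rewrite subr0.
by rewrite E mulfK //; exact: (N1 _ (Zd _ sy)).2.
Unshelve. all: by end_near. Qed.

Definition dderiv f X (v : 'cV[R]_3) : R := \sum_(i < 3) partial i f X * v i 0.

Definition dderiv2 f X (v w : 'cV[R]_3) : R :=
  \sum_(i < 3) (\sum_(j < 3) partial j (partial i f) X * w j 0) * v i 0.

Lemma C1_continuous U f X : open U -> C1_on U f -> U X -> {for X, continuous f}.
Proof.
move=> oU C1 UX; have FX : Filter (nbhs X) by exact: nbhs_filter.
have E : f = fun Y => f X + \sum_(i < 3) slope f X i Y * (Y i 0 - X i 0).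
  by apply/funext => Y; exact: slopeE.
have lim : (fun Y => f X + \sum_(i < 3) slope f X i Y * (Y i 0 - X i 0)) Y
    @[Y --> X] --> f X + \sum_(i < 3) partial i f X * (X i 0 - X i 0).
  apply: cvgD; first exact: cvg_cst.
  apply: cvg_sum => i; apply: cvgM; first exact: (slope_cvg oU C1 UX).
  by apply: cvgB; [exact: (@coord_continuous R 3 1 i 0 X)|exact: cvg_cst].
move: lim; rewrite -E big1 ?addr0 //.
by move=> i _; rewrite subrr mulr0.
Qed.

Lemma continuous_col_at (T : topologicalType) (c : T -> 'cV[R]_3) (t : T) :
  (forall i, {for t, continuous (fun s => c s i 0)}) -> {for t, continuous c}.
Proof.
move=> cc; apply/cvg_ballP => e e0.
have : \forall s \near t, forall i : 'I_3, `|c t i 0 - c s i 0| < e.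
  apply: filter_forall => i.
  by have /cvgrPdist_lt := cc i; apply.
by apply: filterS => s H; split => // i j; rewrite (ord1 j); exact: H.
Qed.

Lemma continuous_col (T : topologicalType) (c : T -> 'cV[R]_3) :
  (forall i, continuous (fun t => c t i 0)) -> continuous c.
Proof. by move=> cc t; apply: continuous_col_at => i; exact: cc. Qed.

Lemma continuous_along (T : topologicalType) U a (c : T -> 'cV[R]_3) :
  (forall X, U X -> {for X, continuous a}) ->
  (forall i, continuous (fun t => c t i 0)) -> (forall t, U (c t)) ->
  continuous (fun t => a (c t)).
Proof.
move=> ca cc Uc t; apply: continuous_comp; first exact: continuous_col.
exact: ca.
Qed.

(** Continuity of the partial derivatives is enough: [slopeE] writes the
    increment of [f] as a sum of convergent slopes times the increments of the
    coordinates. *)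
Lemma chain_rule U f (c : R -> 'cV[R]_3) (c' : 'cV[R]_3) (t : R) :
  open U -> C1_on U f -> U (c t) ->
  (forall i, is_derive t (1:R) (fun s => c s i 0) (c' i 0)) ->
  is_derive t (1:R) (fun s => f (c s)) (dderiv f (c t) c').
Proof.
move=> oU C1 Uc Dc.
have lim : h^-1 *: (((fun s => f (c s)) \o shift t) (h *: (1:R)) - f (c t))
    @[h --> (0:R)^'] --> dderiv f (c t) c'.
  have -> : (fun h : R => h^-1 *: (((fun s => f (c s)) \o shift t) (h *: (1:R)) - f (c t)))
    = fun h => \sum_(i < 3) slope f (c t) i (c (h + t)) *
        (h^-1 *: (((fun s => c s i 0) \o shift t) (h *: (1:R)) - c t i 0)).
    apply/funext => h /=; rewrite [h *: (1:R)]mulr1.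
    rewrite (slopeE f (c t) (c (h + t))) addrC addKr scaler_sumr.
    by apply: eq_bigr => i _; rewrite -scalerAr.
  apply: cvg_sum => i; apply: cvgM; last first.
    by have [d <-] := Dc i; exact: d.
  have cc : {for t, continuous c}.
    apply: continuous_col_at => i0.
    by apply/differentiable_continuous/derivable1_diffP; case: (Dc i0).
  have sh : c (h + t) @[h --> (0:R)^'] --> c t.
    apply: cvg_within_filter.
    have c0 : {for (0:R), continuous (fun h => h + t)}.
      by apply: continuousD; [exact: cvg_id|exact: cvg_cst].
    rewrite /prop_for /continuous_at add0r in c0.
    exact: (cvg_comp _ _ c0 cc).
  exact: (cvg_comp _ _ sh (slope_cvg oU C1 Uc)).
by apply: DeriveDef; [apply/cvg_ex; eexists; exact: lim | exact: cvg_lim].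
Qed.

Lemma chain_rule_dderiv U f (c v : R -> 'cV[R]_3) (c' v' : 'cV[R]_3) (t : R) :
  open U -> C2_on U f -> U (c t) ->
  (forall i, is_derive t (1:R) (fun s => c s i 0) (c' i 0)) ->
  (forall i, is_derive t (1:R) (fun s => v s i 0) (v' i 0)) ->
  is_derive t (1:R) (fun s => dderiv f (c s) (v s))
    (dderiv2 f (c t) (v t) c' + dderiv f (c t) v').
Proof.
move=> oU [_ C2] Uc Dc Dv; rewrite /dderiv /dderiv2 -big_split /=.
apply: is_derive1_sum => i.
exact: (is_derive1_mul (chain_rule oU (C2 i) Uc Dc) (Dv i)).
Qed.

Lemma dderiv_continuous (T : topologicalType) U f (c v : T -> 'cV[R]_3) :
  C1_on U f -> (forall t, U (c t)) ->
  (forall i, continuous (fun t => c t i 0)) ->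
  (forall i, continuous (fun t => v t i 0)) ->
  continuous (fun t => dderiv f (c t) (v t)).
Proof.
move=> C1 Uc cc cv; apply: continuous_sum => i.
apply: continuous_mul => //.
by apply: (continuous_along (U := U)) => // X UX; have [] := C1 i X UX.
Qed.

Lemma dderiv2_continuous (T : topologicalType) U f (c v w : T -> 'cV[R]_3) :
  C2_on U f -> (forall t, U (c t)) ->
  (forall i, continuous (fun t => c t i 0)) ->
  (forall i, continuous (fun t => v t i 0)) ->
  (forall i, continuous (fun t => w t i 0)) ->
  continuous (fun t => dderiv2 f (c t) (v t) (w t)).
Proof.
move=> [_ C2] Uc cc cv cw; apply: continuous_sum => i.
by apply: continuous_mul => //; exact: (dderiv_continuous (C2 i)).
Qed.

Lemma dderivZ f X (k : R) v : dderiv f X (k *: v) = k * dderiv f X v.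
Proof. by rewrite /dderiv big_distrr; apply: eq_bigr => i _; rewrite mxE mulrCA. Qed.

Lemma dderivD f X v w : dderiv f X (v + w) = dderiv f X v + dderiv f X w.
Proof.
by rewrite /dderiv -big_split; apply: eq_bigr => i _; rewrite mxE mulrDr.
Qed.

Lemma dderiv2Zr f X (k : R) v w : dderiv2 f X v (k *: w) = k * dderiv2 f X v w.
Proof.
rewrite /dderiv2 big_distrr; apply: eq_bigr => i _.
have := dderivZ (partial i f) X k w; rewrite /dderiv => ->.
exact: esym (mulrA _ _ _).
Qed.

(** Expression of the spherical Laplacian through an extension of the function
    to the ambient space; it does not mention coordinates, hence commutes with
    rotations. *)
Definition ambient_lap f X : R :=
  \sum_(i < 3) partial i (partial i f) X - dderiv2 f X X X - 2 * dderiv f X X.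

Lemma trace_orthonormal f X (v1 v2 v3 : 'cV[R]_3) :
  (forall i j : 'I_3, v1 i 0 * v1 j 0 + v2 i 0 * v2 j 0 + v3 i 0 * v3 j 0
     = (i == j)%:R) ->
  dderiv2 f X v1 v1 + dderiv2 f X v2 v2 + dderiv2 f X v3 v3
  = \sum_(i < 3) partial i (partial i f) X.
Proof.
move=> O; rewrite /dderiv2 -!big_split; apply: eq_bigr => i _.
rewrite !big_distrl -!big_split /= (bigD1 i) //= big1 => [|j ji].
  rewrite addr0 -!(mulrA (partial i _ _)) -!mulrDr.
  by rewrite O eqxx mulr1.
rewrite -!(mulrA (partial j _ _)) -!mulrDr.
by rewrite O (negbTE ji) mulr0.
Qed.

End Ambient.

(** * Charts of rotated functions *)

Section Spherical.
Variable R : realType.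
Implicit Types (U : set 'cV[R]_3) (f : 'cV[R]_3 -> R) (G : 'M[R]_3).

Definition vec3 (a b c : R) : 'cV[R]_3 := \col_(i < 3) [:: a; b; c]`_i.

Lemma is_derive_vec3 (a b c : R -> R) (a' b' c' : R) (t : R) :
  is_derive t (1:R) a a' -> is_derive t (1:R) b b' -> is_derive t (1:R) c c' ->
  forall i, is_derive t (1:R) (fun s => vec3 (a s) (b s) (c s) i 0)
                              (vec3 a' b' c' i 0).
Proof.
move=> Da Db Dc [[|[|[|//]]] Hi].
- rewrite mxE; have -> // : (fun s => vec3 (a s) (b s) (c s) (Ordinal Hi) 0) = a.
  by apply/funext => s; rewrite mxE.
- rewrite mxE; have -> // : (fun s => vec3 (a s) (b s) (c s) (Ordinal Hi) 0) = b.
  by apply/funext => s; rewrite mxE.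
- rewrite mxE; have -> // : (fun s => vec3 (a s) (b s) (c s) (Ordinal Hi) 0) = c.
  by apply/funext => s; rewrite mxE.
Qed.

Lemma continuous_vec3 (T : topologicalType) (a b c : T -> R) :
  continuous a -> continuous b -> continuous c ->
  forall i, continuous (fun s => vec3 (a s) (b s) (c s) i 0).
Proof.
move=> ca cb cc [[|[|[|//]]] Hi].
- have -> // : (fun s => vec3 (a s) (b s) (c s) (Ordinal Hi) 0) = a.
  by apply/funext => s; rewrite mxE.
- have -> // : (fun s => vec3 (a s) (b s) (c s) (Ordinal Hi) 0) = b.
  by apply/funext => s; rewrite mxE.
- have -> // : (fun s => vec3 (a s) (b s) (c s) (Ordinal Hi) 0) = c.
  by apply/funext => s; rewrite mxE.
Qed.

Lemma is_derive_mulmx G (c : R -> 'cV[R]_3) (c' : 'cV[R]_3) (t : R) :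
  (forall i, is_derive t (1:R) (fun s => c s i 0) (c' i 0)) ->
  forall i, is_derive t (1:R) (fun s => (G *m c s) i 0) ((G *m c') i 0).
Proof.
move=> Dc i.
have -> : (fun s => (G *m c s) i 0) = fun s => \sum_(j < 3) G i j * c s j 0.
  by apply/funext => s; rewrite mxE.
have D j : is_derive t (1:R) (fun s => G i j * c s j 0) (G i j * c' j 0).
  apply: (is_derive1_eq (is_derive1_mul (is_derive1_cst (G i j) t) (Dc j))).
  by rewrite mul0r add0r.
by rewrite mxE; exact: (is_derive1_sum D).
Qed.

Lemma continuous_mulmx (T : topologicalType) G (c : T -> 'cV[R]_3) :
  (forall i, continuous (fun s => c s i 0)) ->
  forall i, continuous (fun s => (G *m c s) i 0).
Proof.
move=> cc i.
have -> : (fun s => (G *m c s) i 0) = fun s => \sum_(j < 3) G i j * c s j 0.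
  by apply/funext => s; rewrite mxE.
by apply: continuous_sum => j; apply: continuous_mul => //; exact: continuous_cst.
Qed.

Lemma sum3 (F : 'I_3 -> R) : \sum_(i < 3) F i = F 0 + F 1 + F (1 + 1).
Proof.
by rewrite !big_ord_recl big_ord0 addr0 addrA; congr (_ + F _ + F _); exact/val_inj.
Qed.

(** With [sphere_point], the vectors [north] and [east] form an orthonormal
    frame; [radial] points to the equator at the given longitude. *)
Definition north (p t : R) := vec3 (- (cos p * sin t)) (- (sin p * sin t)) (cos t).
Definition east (p : R) := vec3 (- sin p) (cos p) 0.
Definition radial (p : R) := vec3 (cos p) (sin p) 0.

Lemma sphere_pointE (p t : R) :
  sphere_point p t = vec3 (cos p * cos t) (sin p * cos t) (sin t).
Proof. by []. Qed.

Lemma orthogonal_frame (p t : R) (i j : 'I_3) :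
  sphere_point p t i 0 * sphere_point p t j 0 + north p t i 0 * north p t j 0
  + east p i 0 * east p j 0 = (i == j)%:R.
Proof.
have Cp := cos2Dsin2 p; have Ct := cos2Dsin2 t.
case: i => [[|[|[|//]]] Hi]; case: j => [[|[|[|//]]] Hj]; rewrite !mxE /=.
- transitivity (cos p ^+ 2 * (cos t ^+ 2 + sin t ^+ 2) + sin p ^+ 2); first by ring.
  by rewrite Ct mulr1 Cp.
- transitivity (cos p * sin p * (cos t ^+ 2 + sin t ^+ 2 - 1)); first by ring.
  by rewrite Ct subrr mulr0.
- by ring.
- transitivity (cos p * sin p * (cos t ^+ 2 + sin t ^+ 2 - 1)); first by ring.
  by rewrite Ct subrr mulr0.
- transitivity (sin p ^+ 2 * (cos t ^+ 2 + sin t ^+ 2) + cos p ^+ 2); first by ring.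
  by rewrite Ct mulr1 addrC Cp.
- by ring.
- by ring.
- by ring.
- by rewrite mulr0 addr0 -!expr2 addrC Ct.
Qed.

Lemma orthogonal_frame_mulmx G (v1 v2 v3 : 'cV[R]_3) : orthogonal_mx G ->
  (forall i j : 'I_3, v1 i 0 * v1 j 0 + v2 i 0 * v2 j 0 + v3 i 0 * v3 j 0
     = (i == j)%:R) ->
  forall i j : 'I_3, (G *m v1) i 0 * (G *m v1) j 0 + (G *m v2) i 0 * (G *m v2) j 0
     + (G *m v3) i 0 * (G *m v3) j 0 = (i == j)%:R.
Proof.
move=> /mulmx1C GG O i j.
have outer (v : 'cV[R]_3) k l : v k 0 * v l 0 = (v *m v^T) k l.
  by rewrite mxE big_ord_recl big_ord0 addr0 mxE.
have E : v1 *m v1^T + v2 *m v2^T + v3 *m v3^T = 1%:M.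
  by apply/matrixP => k l; rewrite 2!mxE -!outer O mxE.
rewrite !outer.
have trG (v : 'cV[R]_3) : G *m v *m (G *m v)^T = G *m (v *m v^T) *m G^T.
  by rewrite trmx_mul !mulmxA.
rewrite !trG.
have := congr1 (fun M => (G *m M *m G^T) i j) E.
by rewrite mulmx1 GG !mulmxDr !mulmxDl !mxE.
Qed.

Lemma sphere2_mulmx G X : orthogonal_mx G -> sphere2 X -> sphere2 (G *m X).
Proof.
have E (Y : 'cV[R]_3) : \sum_(i < 3) Y i 0 ^+ 2 = (Y^T *m Y) 0 0.
  by rewrite mxE; apply: eq_bigr => i _; rewrite mxE expr2.
rewrite /sphere2 /orthogonal_mx /= !E => GG.
by rewrite trmx_mul mulmxA -(mulmxA X^T) GG mulmx1.
Qed.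

Lemma sphere2_point (p t : R) : sphere2 (sphere_point p t).
Proof.
rewrite /sphere2 /= sum3 !mxE /=.
transitivity ((cos p ^+ 2 + sin p ^+ 2) * cos t ^+ 2 + sin t ^+ 2); first by ring.
by rewrite cos2Dsin2 mul1r cos2Dsin2.
Qed.

Lemma orthogonal_mx1 : orthogonal_mx (1%:M : 'M[R]_3).
Proof. by rewrite /orthogonal_mx trmx1 mulmx1. Qed.

Lemma orthogonal_mxM G H :
  orthogonal_mx G -> orthogonal_mx H -> orthogonal_mx (G *m H).
Proof.
rewrite /orthogonal_mx trmx_mul => GG HH.
by rewrite -mulmxA (mulmxA G^T) GG mul1mx.
Qed.

(** Symmetry of second derivatives, from differentiation under the integral
    sign in [u y t = u c t + intg c y (u_p ^~ t)]. *)
Lemma schwarz (u ut up a b : R -> R -> R) :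
  continuous2 up -> continuous2 a -> continuous2 b ->
  (forall p, has_derivative (u p) (ut p)) ->
  (forall t, has_derivative (u ^~ t) (up ^~ t)) ->
  (forall t, has_derivative (ut ^~ t) (a ^~ t)) ->
  (forall p, has_derivative (up p) (b p)) ->
  forall p t, a p t = b p t.
Proof.
move=> cup ca cb Dut Dup Da Db x t.
pose c := x - 1.
have cbt s : continuous (b ^~ s) by cont.
have cupt s : continuous (up ^~ s) by cont.
have [B DB] := primitive_exists (cbt t).
have H y : c <= y -> ut y t - ut c t = B y - B c.
  move=> cy.
  have D1 : is_derive t (1:R) (fun s => intg c y (up ^~ s)) (intg c y (b ^~ t)).
    apply: (is_derive_intg (g := fun s p => up p s) (dg := fun s p => b p s)) => //.
    exact: (continuous2_flip cb).
  have D2 : is_derive t (1:R) (fun s => u y s - u c s) (ut y t - ut c t).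
    by have d1 := Dut y; have d2 := Dut c; isd.
  have E : (fun s => intg c y (up ^~ s)) = fun s => u y s - u c s.
    by apply/funext => s; exact: (intgE cy (cupt s) (Dup s)).
  rewrite E (intgE cy (cbt t) DB) in D1.
  by case: D1 => _ <-; case: D2 => _ <-.
have Dx : is_derive x (1:R) (ut ^~ t) (b x t).
  apply: (near_eq_is_derive (f := fun y => ut c t + (B y - B c))).
    have xc : x \in `]c, x + 1[%R by rewrite in_itv /= /c; apply/andP; split; lra.
    have := near_in_itvoo xc; apply: filterS => y.
    by rewrite in_itv /= => /andP[cy _]; rewrite -H ?ltW // addrCA subrr addr0.
  by isd; ring.
have [_ E1] := Da t x; have [_ E2] := Dx.
exact: etrans (esym E1) E2.
Qed.

Section ChartOf.
Variables (U : set 'cV[R]_3) (f : 'cV[R]_3 -> R).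
Hypotheses (oU : open U) (sU : sphere2 `<=` U) (fC2 : C2_on U f).
Variables (G : 'M[R]_3) (oG : orthogonal_mx G).

Let c p t := G *m sphere_point p t.
Let vn p t := G *m north p t.
Let ve p := G *m east p.

Let Uc p t : U (c p t).
Proof. exact/sU/sphere2_mulmx/sphere2_point. Qed.

Let fC1 : C1_on U f := fC2.1.

Let u p t := f (c p t).
Let ut p t := dderiv f (c p t) (vn p t).
Let q p t := dderiv f (c p t) (ve p).
Let up p t := cos t * q p t.
Let utt p t := dderiv2 f (c p t) (vn p t) (vn p t) - dderiv f (c p t) (c p t).
Let utp p t := cos t * dderiv2 f (c p t) (vn p t) (ve p) - sin t * q p t.
Let upp p t := cos t *
  (cos t * dderiv2 f (c p t) (ve p) (ve p) - dderiv f (c p t) (G *m radial p)).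
(* Trace of the second derivative over the tangent plane, and the contribution
   of the curvature of the sphere. *)
Let lap p t := dderiv2 f (c p t) (vn p t) (vn p t) + dderiv2 f (c p t) (ve p) (ve p)
  - 2 * dderiv f (c p t) (c p t).

Let dct p t i : is_derive t (1:R) (fun s => c p s i 0) (vn p t i 0).
Proof.
move: i; apply: is_derive_mulmx; apply: is_derive_vec3; isd; ring.
Qed.

Let dcp p t i : is_derive p (1:R) (fun s => c s t i 0) ((cos t *: ve p) i 0).
Proof.
rewrite /ve scalemxAr; move: i; apply: is_derive_mulmx => i.
have -> : cos t *: east p = vec3 (- (sin p * cos t)) (cos p * cos t) 0.
  apply/colP; case=> [[|[|[|//]]] Hi]; rewrite !mxE /=; ring.
by move: i; apply: is_derive_vec3; isd; ring.
Qed.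

Let dvnt p t i : is_derive t (1:R) (fun s => vn p s i 0) ((- c p t) i 0).
Proof.
rewrite /c -mulmxN; move: i; apply: is_derive_mulmx => i.
have -> : - sphere_point p t = vec3 (- (cos p * cos t)) (- (sin p * cos t)) (- sin t).
  by apply/colP; case=> [[|[|[|//]]] Hi]; rewrite !mxE /=.
by move: i; apply: is_derive_vec3; isd; ring.
Qed.

Let dvnp p t i :
  is_derive p (1:R) (fun s => vn s t i 0) ((- sin t *: ve p) i 0).
Proof.
rewrite /ve scalemxAr; move: i; apply: is_derive_mulmx => i.
have -> : - sin t *: east p = vec3 (sin p * sin t) (- (cos p * sin t)) 0.
  apply/colP; case=> [[|[|[|//]]] Hi]; rewrite !mxE /=; ring.
by move: i; apply: is_derive_vec3; isd; ring.
Qed.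

Let dvep p i : is_derive p (1:R) (fun s => ve s i 0) ((- (G *m radial p)) i 0).
Proof.
rewrite -mulmxN; move: i; apply: is_derive_mulmx => i.
have -> : - radial p = vec3 (- cos p) (- sin p) 0.
  by apply/colP; case=> [[|[|[|//]]] Hi]; rewrite !mxE /= ?oppr0.
by move: i; apply: is_derive_vec3; isd; ring.
Qed.

Let cc i : continuous (fun x : R * R => c x.1 x.2 i 0).
Proof. move: i; apply: continuous_mulmx; apply: continuous_vec3; cont. Qed.

Let cvn i : continuous (fun x : R * R => vn x.1 x.2 i 0).
Proof. move: i; apply: continuous_mulmx; apply: continuous_vec3; cont. Qed.

Let cve i : continuous (fun x : R * R => ve x.1 i 0).
Proof. move: i; apply: continuous_mulmx; apply: continuous_vec3; cont. Qed.

Let cvr i : continuous (fun x : R * R => (G *m radial x.1) i 0).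
Proof. move: i; apply: continuous_mulmx; apply: continuous_vec3; cont. Qed.

Let D1c (v : R * R -> 'cV[R]_3) : (forall i, continuous (fun x => v x i 0)) ->
  continuous (fun x : R * R => dderiv f (c x.1 x.2) (v x)).
Proof. by move=> cv; apply: (dderiv_continuous fC1) => // x; exact: Uc. Qed.

Let D2c (v w : R * R -> 'cV[R]_3) : (forall i, continuous (fun x => v x i 0)) ->
  (forall i, continuous (fun x => w x i 0)) ->
  continuous (fun x : R * R => dderiv2 f (c x.1 x.2) (v x) (w x)).
Proof. by move=> cv cw; apply: (dderiv2_continuous fC2) => // x; exact: Uc. Qed.

Let cu : continuous2 u.
Proof.
apply: (@continuous_along R _ U f (fun x : R * R => c x.1 x.2)).
- by move=> X UX; exact: (C1_continuous oU fC1 UX).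
- exact: cc.
- by move=> x; exact: Uc.
Qed.

Let cut : continuous2 ut. Proof. exact: D1c. Qed.
Let cq : continuous2 q. Proof. exact: D1c. Qed.
Let cup : continuous2 up. Proof. by rewrite /up; cont. Qed.
Let cnn : continuous2 (fun p t => dderiv2 f (c p t) (vn p t) (vn p t)).
Proof. exact: D2c. Qed.
Let cee : continuous2 (fun p t => dderiv2 f (c p t) (ve p) (ve p)).
Proof. exact: D2c. Qed.
Let cne : continuous2 (fun p t => dderiv2 f (c p t) (vn p t) (ve p)).
Proof. exact: D2c. Qed.
Let cen : continuous2 (fun p t => dderiv2 f (c p t) (ve p) (vn p t)).
Proof. exact: D2c. Qed.
Let c1 : continuous2 (fun p t => dderiv f (c p t) (c p t)).
Proof. exact: D1c. Qed.
Let c1r : continuous2 (fun p t => dderiv f (c p t) (G *m radial p)).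
Proof. exact: D1c. Qed.

Let cutt : continuous2 utt.
Proof. by apply: continuous_add => //; exact: continuous_opp. Qed.
Let cutp : continuous2 utp.
Proof.
rewrite /utp; apply: continuous_add; last by cont.
by apply: continuous_mul => //; cont.
Qed.
Let cupp : continuous2 upp.
Proof.
apply: continuous_mul; first by cont.
apply: continuous_add; last exact: continuous_opp.
by apply: continuous_mul => //; cont.
Qed.
Let clap : continuous2 lap.
Proof.
apply: continuous_add; first by apply: continuous_add.
by apply/continuous_opp/continuous_mul => //; exact: continuous_cst.
Qed.

Let Dut p : has_derivative (u p) (ut p).
Proof. move=> t; exact: (chain_rule oU fC1 (Uc p t) (dct p t)). Qed.

Let Dup t : has_derivative (u ^~ t) (up ^~ t).
Proof.
move=> p; have D := chain_rule (c := c ^~ t) oU fC1 (Uc p t) (dcp p t).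
by rewrite dderivZ in D; exact: D.
Qed.

Let Dutt p : has_derivative (ut p) (utt p).
Proof.
move=> t; have D := chain_rule_dderiv (c := c p) oU fC2 (Uc p t) (dct p t) (dvnt p t).
by rewrite -scaleN1r dderivZ mulN1r in D; exact: D.
Qed.

Let Dutp t : has_derivative (ut ^~ t) (utp ^~ t).
Proof.
move=> p.
have D := chain_rule_dderiv (c := c ^~ t) (v := vn ^~ t) oU fC2 (Uc p t) (dcp p t)
  (dvnp p t).
by rewrite dderivZ dderiv2Zr mulNr in D; exact: D.
Qed.

Let Dupp t : has_derivative (up ^~ t) (upp ^~ t).
Proof.
move=> p.
have D := chain_rule_dderiv (c := c ^~ t) (v := ve) oU fC2 (Uc p t) (dcp p t)
  (dvep p).
rewrite /up /q; isd; rewrite -scaleN1r dderivZ dderiv2Zr /upp; ring.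
Qed.

Let upt p t := cos t * dderiv2 f (c p t) (ve p) (vn p t) - sin t * q p t.

Let Dupt p : has_derivative (up p) (upt p).
Proof.
move=> t.
have D0 i : is_derive t (1:R) (fun s => ve p i 0) ((0 : 'cV[R]_3) i 0).
  have -> : (0 : 'cV[R]_3) i 0 = 0 by rewrite mxE.
  exact: is_derive1_cst.
have D := chain_rule_dderiv (c := c p) (v := fun=> ve p) oU fC2 (Uc p t) (dct p t) D0.
have z : dderiv f (c p t) 0 = 0 by rewrite -(scale0r 0) dderivZ mul0r.
by rewrite /up /q; isd; rewrite z /upt /q; ring.
Qed.

Let cupt : continuous2 upt.
Proof.
rewrite /upt; apply: continuous_add; last by cont.
by apply: continuous_mul => //; cont.
Qed.

Let Dupt' p : has_derivative (up p) (utp p).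
Proof.
move=> t; rewrite (schwarz cup cutp cupt Dut Dup Dutp Dupt); exact: Dupt.
Qed.

Let c_per p t : c (p + 2 * pi) t = c p t.
Proof. by rewrite /c !sphere_pointE cosDtwopi sinDtwopi. Qed.
Let vn_per p t : vn (p + 2 * pi) t = vn p t.
Proof. by rewrite /vn /north cosDtwopi sinDtwopi. Qed.
Let ve_per p : ve (p + 2 * pi) = ve p.
Proof. by rewrite /ve /east cosDtwopi sinDtwopi. Qed.

Let lapE p t : cos t != 0 ->
  lap p t = utt p t - tan t * ut p t + (cos t ^+ 2)^-1 * upp p t.
Proof.
move=> ct.
have E : cos t *: c p t = sin t *: vn p t + G *m radial p.
  rewrite /c /vn !scalemxAr -mulmxDr; congr (_ *m _); apply/colP.
  have CS := cos2Dsin2 t.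
  case=> [[|[|[|//]]] Hi]; rewrite !mxE /=.
  - transitivity (cos p * (cos t ^+ 2 + sin t ^+ 2) - cos p * sin t ^+ 2).
      by ring.
    by rewrite CS; ring.
  - transitivity (sin p * (cos t ^+ 2 + sin t ^+ 2) - sin p * sin t ^+ 2).
      by ring.
    by rewrite CS; ring.
  - by ring.
have := congr1 (dderiv f (c p t)) E; rewrite dderivD !dderivZ => E1.
have Er : dderiv f (c p t) (G *m radial p) =
    cos t * dderiv f (c p t) (c p t) - sin t * dderiv f (c p t) (vn p t).
  by rewrite E1; ring.
rewrite /lap /utt /ut /upp Er /tan.
by field.
Qed.

(** The function [X |-> f (G *m X)] read in longitude and latitude. *)
Definition chart_of : chart R.
Proof.
refine (@Chart R u ut up utt utp upp q lap cu cut cup cutt cutp cupp cq clap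
  Dut Dup Dutt Dutp Dupt' Dupp _ _ _ _ lapE).
- by [].
- by move=> p t; rewrite /u c_per.
- by move=> p t; rewrite /ut c_per vn_per.
- by move=> p t; rewrite /up /q c_per ve_per.
Defined.

Lemma chart_ofE p t : chart_of p t = f (G *m sphere_point p t).
Proof. by []. Qed.

(** The trace over the tangent plane is the full trace minus the normal term, in
    the rotated frame as well. *)
Lemma chart_of_lap p t :
  ch_lap chart_of p t = ambient_lap f (G *m sphere_point p t).
Proof.
rewrite /= /lap /ambient_lap.
have O := orthogonal_frame_mulmx oG (orthogonal_frame p t).
by rewrite -(trace_orthonormal f (c p t) O) -/(vn p t) -/(ve p) -/(c p t); ring.
Qed.

End ChartOf.

End Spherical.

(** * Rotations and moments *)

Section RotationByParts.
Variables (R : realType) (h : chart R) (x xt xq : R -> R -> R).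
Hypotheses (cx : continuous2 x) (cxt : continuous2 xt) (cxq : continuous2 xq).
Hypothesis Dxt : forall p, has_derivative (x p) (xt p).
Hypothesis Dxp : forall t, has_derivative (x ^~ t) (fun p => cos t * xq p t).
Hypothesis x_per : forall t, x (2 * pi) t = x 0 t.

(** The derivation [sin p * d/dt - tan t * cos p * d/dp] generating the
    rotations about the first axis is skew-adjoint on the sphere. *)
Lemma rotation_by_parts :
  lat (fun t => cos t * circ (fun p =>
    (sin p * ch_t h p t - sin t * cos p * ch_q h p t) * x p t)) =
  - lat (fun t => cos t * circ (fun p =>
    h p t * (sin p * xt p t - sin t * cos p * xq p t))).
Proof.
have c_h := @ch_cont R h; have c_ht := @ch_t_cont R h; have c_q := @ch_q_cont R h.
pose X p t := (sin p * ch_t h p t - sin t * cos p * ch_q h p t) * x p t.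
pose Y p t := h p t * (sin p * xt p t - sin t * cos p * xq p t).
have cX : continuous2 X by rewrite /X; cont.
have cY : continuous2 Y by rewrite /Y; cont.
have ccX := circ_continuous cX; have ccY := circ_continuous cY.
pose S t := circ (fun p => sin p * (h p t * x p t)).
pose S' t := circ (fun p => sin p * (ch_t h p t * x p t + h p t * xt p t)).
have DS : has_derivative S S'.
  apply: (is_derive_circ (g := fun p t => sin p * (h p t * x p t))
    (dg := fun p t => sin p * (ch_t h p t * x p t + h p t * xt p t)));
    [by cont|by cont|].
  by move=> p t; have D1 := ch_dt h p; have D2 := Dxt p; isd; ring.
have cS' : continuous S'.
  apply: (circ_continuous
    (g := fun p t => sin p * (ch_t h p t * x p t + h p t * xt p t))).
  by cont.
have E t : cos t * circ (X ^~ t) + cos t * circ (Y ^~ t)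
    = - sin t * S t + cos t * S' t.
  pose N p := - sin p * (h p t * x p t)
    + cos p * (cos t * ch_q h p t * x p t + h p t * (cos t * xq p t)).
  have cN : continuous N by rewrite /N; cont.
  have N0 : circ N = 0.
    apply: (circ_derivative (G := fun p => cos p * (h p t * x p t)) cN).
    - move=> p; have D1 := ch_dp h t; have D2 := Dxp t; rewrite /N; isd.
      by rewrite ch_qE; ring.
    - by rewrite cos_2pi cos0 x_per; have := ch_per h 0 t; rewrite add0r => ->.
  transitivity (cos t * circ (X ^~ t) + (cos t * circ (Y ^~ t) + sin t * circ N)).
    by rewrite N0; ring.
  have cXt : continuous (X ^~ t) by cont.
  have cYt : continuous (Y ^~ t) by cont.
  rewrite /S /S' -!circ_scale //; [|by cont..].
  do 3 (rewrite -circ_add; [|by cont..]).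
  by congr circ; apply/funext => p; rewrite /X /Y /N; ring.
have := @intgE R _ _ (fun t => - sin t * S t + cos t * S' t)
  (fun t => cos t * S t) (lat_le R).
rewrite cosN cos_pihalf !mul0r subrr => H.
have cS := is_derive_continuous DS.
have {H} : lat (fun t => - sin t * S t + cos t * S' t) = 0.
  by apply: H; [cont|move=> t; isd; ring].
have -> : (fun t => - sin t * S t + cos t * S' t) =
    fun t => cos t * circ (X ^~ t) + cos t * circ (Y ^~ t).
  by apply/funext => t; rewrite E.
rewrite /lat intg_add ?lat_le //; [|by cont..].
by move=> /eqP; rewrite addr_eq0 => /eqP.
Qed.

End RotationByParts.

Section Rotations.
Variable R : realType.

Definition mat3 (r1 r2 r3 : seq R) : 'M[R]_3 :=
  \matrix_(i < 3, j < 3) nth 0 (nth [::] [:: r1; r2; r3] i) j.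

Definition rot_z (s : R) := mat3 [:: cos s; - sin s; 0] [:: sin s; cos s; 0] [:: 0; 0; 1].
Definition rot_x (s : R) := mat3 [:: 1; 0; 0] [:: 0; cos s; - sin s] [:: 0; sin s; cos s].

Lemma mat3_mulmx (a11 a12 a13 a21 a22 a23 a31 a32 a33 x y z : R) :
  mat3 [:: a11; a12; a13] [:: a21; a22; a23] [:: a31; a32; a33] *m vec3 x y z =
  vec3 (a11 * x + a12 * y + a13 * z) (a21 * x + a22 * y + a23 * z)
       (a31 * x + a32 * y + a33 * z).
Proof.
by apply/colP; case=> [[|[|[|//]]] Hi]; rewrite mxE sum3 !mxE.
Qed.

Lemma orthogonal_rot_z s : orthogonal_mx (rot_z s).
Proof.
have CS := cos2Dsin2 s.
apply/matrixP; case=> [[|[|[|//]]] Hi]; case=> [[|[|[|//]]] Hj];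
  rewrite mxE sum3 !mxE /=; try ring; rewrite -[RHS]CS; ring.
Qed.

Lemma orthogonal_rot_x s : orthogonal_mx (rot_x s).
Proof.
have CS := cos2Dsin2 s.
apply/matrixP; case=> [[|[|[|//]]] Hi]; case=> [[|[|[|//]]] Hj];
  rewrite mxE sum3 !mxE /=; try ring; rewrite -[RHS]CS; ring.
Qed.

Lemma rot_z_point (s p t : R) :
  rot_z s *m sphere_point p t = sphere_point (p + s) t.
Proof.
by rewrite !sphere_pointE mat3_mulmx cosD sinD; congr vec3; ring.
Qed.

Lemma rot_x0 : rot_x 0 = 1%:M.
Proof.
apply/matrixP; case=> [[|[|[|//]]] Hi]; case=> [[|[|[|//]]] Hj];
  by rewrite !mxE /= ?cos0 ?sin0 ?oppr0.
Qed.

Lemma harmonic_oscillator (a b : R -> R) :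
  has_derivative a b -> has_derivative b (fun s => - a s) ->
  forall s, a s = cos s * a 0 + sin s * b 0.
Proof.
move=> Da Db s.
pose P s := a s * cos s - b s * sin s.
pose Q s := a s * sin s + b s * cos s.
have DP : has_derivative P (fun=> 0) by move=> y; rewrite /P; isd; ring.
have DQ : has_derivative Q (fun=> 0) by move=> y; rewrite /Q; isd; ring.
have EP : P s = a 0 by rewrite (is_derive_0_is_cst s 0 DP) /P cos0 sin0; ring.
have EQ : Q s = b 0 by rewrite (is_derive_0_is_cst s 0 DQ) /Q cos0 sin0; ring.
transitivity (a s * (cos s ^+ 2 + sin s ^+ 2)); first by rewrite cos2Dsin2 mulr1.
by rewrite -EP -EQ /P /Q; ring.
Qed.

Lemma exists_angle (a b : R) : exists s : R, cos s * a + sin s * b = 0.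
Proof.
have pi0 : 0 <= (pi : R) := pi_ge0 R.
have [||s _ E] := @IVT R (fun s => cos s * a + sin s * b) 0 pi 0 pi0.
- by apply: continuous_subspaceT; cont.
- rewrite cos0 sin0 cospi sinpi !mul0r !addr0 mul1r mulN1r.
  rewrite ge_min le_max; have [a0|a0] := leP a 0.
  + by rewrite /= oppr_ge0 a0 orbT.
  + by rewrite oppr_le0 (ltW a0) orbT.
- by exists s.
Qed.

Section Family.
Variables (U : set 'cV[R]_3) (f : 'cV[R]_3 -> R).
Hypotheses (oU : open U) (sU : sphere2 `<=` U) (fC2 : C2_on U f).
Variables (G : 'M[R]_3) (oG : orthogonal_mx G).

Let oGx s : orthogonal_mx (G *m rot_x s) := orthogonal_mxM oG (orthogonal_rot_x s).
Let h s : chart R := chart_of oU sU fC2 (oGx s).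

(* The point [rot_x s *m sphere_point p t] and its derivative in [s]. *)
Let pt (s p t : R) := vec3 (cos p * cos t)
  (cos s * (sin p * cos t) - sin s * sin t) (sin s * (sin p * cos t) + cos s * sin t).
Let pt' (s p t : R) := vec3 0
  (- sin s * (sin p * cos t) - cos s * sin t) (cos s * (sin p * cos t) - sin s * sin t).

Let ptE s p t : G *m rot_x s *m sphere_point p t = G *m pt s p t.
Proof.
rewrite -mulmxA; congr (_ *m _); rewrite sphere_pointE mat3_mulmx.
by congr vec3; ring.
Qed.

Let U_pt s p t : U (G *m pt s p t).
Proof. by rewrite -ptE; exact/sU/sphere2_mulmx/sphere2_point. Qed.

Let v s p t := f (G *m pt s p t).
Let v' s p t := dderiv f (G *m pt s p t) (G *m pt' s p t).

Let hE : (fun s => ch (h s)) = v.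
Proof.
apply/funext => s; apply/funext => p; apply/funext => t.
by rewrite chart_ofE ptE.
Qed.

Let Dv p t : has_derivative (v ^~ p ^~ t) (v' ^~ p ^~ t).
Proof.
move=> s; apply: (chain_rule (c := fun s => G *m pt s p t) oU fC2.1 (U_pt s p t)).
by apply: is_derive_mulmx; apply: is_derive_vec3; isd; ring.
Qed.

Let v'E s p t :
  v' s p t = sin p * ch_t (h s) p t - sin t * cos p * ch_q (h s) p t.
Proof.
have E : G *m pt' s p t = sin p *: (G *m rot_x s *m north p t)
    + (- (sin t * cos p)) *: (G *m rot_x s *m east p).
  rewrite !scalemxAr -mulmxDr -mulmxA; congr (_ *m _).
  have -> : sin p *: north p t + (- (sin t * cos p)) *: east p =
      vec3 0 (- sin t) (sin p * cos t).
    apply/colP; case=> [[|[|[|//]]] Hi]; rewrite !mxE /=.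
    - by ring.
    - transitivity (- sin t * (cos p ^+ 2 + sin p ^+ 2)); first by ring.
      by rewrite cos2Dsin2 mulr1.
    - by ring.
  by rewrite mat3_mulmx; congr vec3; ring.
by rewrite /= ptE /v' E dderivD !dderivZ; ring.
Qed.

Let c_pt (T : topologicalType) (s p t : T -> R) :
  continuous s -> continuous p -> continuous t ->
  forall i, continuous (fun y => (G *m pt (s y) (p y) (t y)) i 0).
Proof.
by move=> cs cp ct; apply: continuous_mulmx; apply: continuous_vec3; cont.
Qed.

Let c_pt' (T : topologicalType) (s p t : T -> R) :
  continuous s -> continuous p -> continuous t ->
  forall i, continuous (fun y => (G *m pt' (s y) (p y) (t y)) i 0).
Proof.
by move=> cs cp ct; apply: continuous_mulmx; apply: continuous_vec3; cont.
Qed.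

Let c_v (T : topologicalType) (s p t : T -> R) :
  continuous s -> continuous p -> continuous t ->
  continuous (fun y => v (s y) (p y) (t y)).
Proof.
move=> cs cp ct.
apply: (@continuous_along R _ U f (fun y => G *m pt (s y) (p y) (t y))).
- by move=> X UX; exact: (C1_continuous oU fC2.1 UX).
- exact: c_pt.
- by move=> y; exact: U_pt.
Qed.

Let c_v' (T : topologicalType) (s p t : T -> R) :
  continuous s -> continuous p -> continuous t ->
  continuous (fun y => v' (s y) (p y) (t y)).
Proof.
move=> cs cp ct; apply: (dderiv_continuous fC2.1).
- by move=> y; exact: U_pt.
- exact: c_pt.
- exact: c_pt'.
Qed.

Let mom (w : R -> R -> R -> R) (x : R -> R -> R) (s : R) :=
  lat (fun t => cos t * circ (fun p => w s p t * x p t)).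
Let K := mom (fun s => ch (h s)).

Let DK (x : R -> R -> R) : continuous2 x -> has_derivative (K x)
  (mom v' x).
Proof.
move=> cx s; rewrite /K hE.
have c0 (w : R -> R -> R -> R) : continuous (fun y : R * (R * R) => w y.2.1 y.1 y.2.2) ->
    continuous2 (fun s t => cos t * circ (fun p => w s p t * x p t)).
  move=> cw.
  have c1 : continuous2 (fun (p : R) (y : R * R) => w y.1 p y.2 * x p y.2).
    by rewrite /continuous2; apply: continuous_mul => //; cont.
  have c2 : continuous2 (fun s t => circ (fun p => w s p t * x p t)).
    exact: (circ_continuous c1).
  by cont.
have cg : continuous2 (fun s t => cos t * circ (fun p => v s p t * x p t)).
  apply: (c0 v); apply: (@c_v (R * (R * R))%type (fun y => y.2.1) (fun y => y.1)
    (fun y => y.2.2)); by cont.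
have cdg : continuous2 (fun s t => cos t * circ (fun p => v' s p t * x p t)).
  apply: (c0 v'); apply: (@c_v' (R * (R * R))%type (fun y => y.2.1) (fun y => y.1)
    (fun y => y.2.2)); by cont.
apply: (is_derive_intg (g := fun s t => cos t * circ (fun p => v s p t * x p t))
  (dg := fun s t => cos t * circ (fun p => v' s p t * x p t))).
- exact: lat_le.
- by move=> s'; exact: (@continuous2_slice R R R
    (fun s t => cos t * circ (fun p => v s p t * x p t)) s' cg).
- exact: cdg.
- move=> t.
  have D : has_derivative (fun s => circ (fun p => v s p t * x p t))
      (fun s => circ (fun p => v' s p t * x p t)).
    apply: (is_derive_circ (g := fun p s => v s p t * x p t)
      (dg := fun p s => v' s p t * x p t)).
    + apply: continuous_mul; last by cont.
      by apply: (@c_v (R * R)%type (fun y => y.2) (fun y => y.1) (fun=> t)); cont.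
    + apply: continuous_mul; last by cont.
      by apply: (@c_v' (R * R)%type (fun y => y.2) (fun y => y.1) (fun=> t)); cont.
    + by move=> p s'; have Dv1 := Dv p t; isd; ring.
  by move=> s'; isd; ring.
Qed.

Let x1 (p t : R) := cos p * cos t.
Let x2 (p t : R) := sin p * cos t.
Let x3 (p t : R) := sin t.

(* [e * y] is the derivative of the coordinate [x] along the rotations. *)
Let DK_by_parts (x xt xq y : R -> R -> R) (e : R) :
  continuous2 x -> continuous2 xt -> continuous2 xq ->
  (forall p, has_derivative (x p) (xt p)) ->
  (forall t, has_derivative (x ^~ t) (fun p => cos t * xq p t)) ->
  (forall t, x (2 * pi) t = x 0 t) -> continuous2 y ->
  (forall p t, sin p * xt p t - sin t * cos p * xq p t = e * y p t) ->
  has_derivative (K x) (fun s => - (e * K y s)).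
Proof.
move=> cx cxt cxq Dxt Dxp per cy xy s; apply: (is_derive1_eq (DK cx s)).
have E := rotation_by_parts (h s) cx cxt cxq Dxt Dxp per.
apply: etrans (etrans E _).
- congr lat; apply/funext => t; congr (_ * _); congr circ.
  by apply/funext => p; congr (_ * _); exact: v'E.
- have c_h := @ch_cont R (h s).
  have cw : continuous2 (fun p t => h s p t * y p t) by cont.
  have ccw := circ_continuous cw.
  rewrite /K /mom /lat -intg_scale ?lat_le //; last by cont.
  congr (- _); congr intg; apply/funext => t.
  transitivity (cos t * (e * circ (fun p => h s p t * y p t))); last by ring.
  rewrite -(circ_scale e); last by cont.
  congr (_ * _); congr circ; apply/funext => p.
  by rewrite xy; ring.
Qed.

Let DK1 : has_derivative (K x1) (fun=> 0).
Proof.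
move=> s; apply: (is_derive1_eq (DK_by_parts (y := x1) (e := 0)
  (xt := fun p t => - (cos p * sin t)) (xq := fun p t => - sin p)
  _ _ _ _ _ _ _ _ s)).
- by rewrite /x1; cont.
- by cont.
- by cont.
- by move=> p t; rewrite /x1; isd; ring.
- by move=> t p; rewrite /x1; isd; ring.
- by move=> t; rewrite /x1 cos_2pi cos0.
- by rewrite /x1; cont.
- by move=> p t; ring.
- by rewrite mul0r oppr0.
Qed.

Let DK2 : has_derivative (K x2) (K x3).
Proof.
move=> s; apply: (is_derive1_eq (DK_by_parts (y := x3) (e := -1)
  (xt := fun p t => - (sin p * sin t)) (xq := fun p t => cos p)
  _ _ _ _ _ _ _ _ s)).
- by rewrite /x2; cont.
- by cont.
- by cont.
- by move=> p t; rewrite /x2; isd; ring.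
- by move=> t p; rewrite /x2; isd; ring.
- by move=> t; rewrite /x2 sin_2pi sin0.
- by rewrite /x3; cont.
- move=> p t; rewrite /x3.
  transitivity (- sin t * (cos p ^+ 2 + sin p ^+ 2)); first by ring.
  by rewrite cos2Dsin2; ring.
- by rewrite mulN1r opprK.
Qed.

Let DK3 : has_derivative (K x3) (fun s => - K x2 s).
Proof.
move=> s; apply: (is_derive1_eq (DK_by_parts (y := x2) (e := 1)
  (xt := fun p t => cos t) (xq := fun p t => 0) _ _ _ _ _ _ _ _ s)).
- by rewrite /x3; cont.
- by cont.
- by cont.
- by move=> p t; rewrite /x3; isd; ring.
- by move=> t p; rewrite /x3; isd; ring.
- by [].
- by rewrite /x2; cont.
- by move=> p t; rewrite /x2; ring.
- by rewrite mul1r.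
Qed.

Let K1E s : moment1 (h s) = K x1 s.
Proof.
have c := @ch_cont R (h s).
congr lat; apply/funext => t; rewrite /x1 expr2 -mulrA -(circ_scale (cos t)); last by cont.
by congr (_ * _); congr circ; apply/funext => p; ring.
Qed.

Let K2E s : moment2 (h s) = K x2 s.
Proof.
have c := @ch_cont R (h s).
congr lat; apply/funext => t; rewrite /x2 expr2 -mulrA -(circ_scale (cos t)); last by cont.
by congr (_ * _); congr circ; apply/funext => p; ring.
Qed.

(** Along the rotations about the first axis the first moment is constant, while
    the moments against the second and third coordinates solve the harmonic
    oscillator, so that the second one has a zero. *)
Lemma rotation_kills_moment2 : moment1 (chart_of oU sU fC2 oG) = 0 ->
  exists s, moment1 (chart_of oU sU fC2 (oGx s)) = 0 /\
            moment2 (chart_of oU sU fC2 (oGx s)) = 0.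
Proof.
move=> m0.
have [s sE] := exists_angle (K x2 0) (K x3 0).
exists s; rewrite -!/(h _) K1E K2E; split.
  have -> : K x1 s = K x1 0 by exact: is_derive_0_is_cst DK1.
  rewrite -K1E -[RHS]m0; congr moment1; apply/funext => p; apply/funext => t.
  by rewrite /= rot_x0 mulmx1.
by rewrite (harmonic_oscillator DK2 DK3).
Qed.

End Family.

End Rotations.

(** * Zonality of the solutions *)

Section Assembly.
Variable R : realType.

Lemma has_derivativeE (F F' : R -> R) : has_derivative F F' -> derive1 F = F'.
Proof. by move=> D; apply/funext => x; rewrite derive1E; case: (D x). Qed.

Lemma laplace_beltrami_chart (psi : 'cV[R]_3 -> R) (h : chart R) (p t : R) :
  (forall p t, psi (sphere_point p t) = h p t) -> cos t != 0 ->
  laplace_beltrami psi p t = ch_lap h p t.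
Proof.
move=> E ct; rewrite /laplace_beltrami.
have -> : (fun t' => psi (sphere_point p t')) = h p by apply/funext => x; exact: E.
have -> : (fun p' => psi (sphere_point p' t)) = h ^~ t.
  by apply/funext => x; exact: E.
rewrite !derive1nS !derive1n0 (has_derivativeE (ch_dt h p)).
rewrite (has_derivativeE (ch_dtt h p)) (has_derivativeE (ch_dp h t)).
by rewrite (has_derivativeE (ch_dpp h t)) ch_lapE.
Qed.

Lemma polar_angle (a b : R) : a ^+ 2 + b ^+ 2 = 1 ->
  exists p : R, a = cos p /\ b = sin p.
Proof.
move=> ab1.
have a1 : -1 <= a <= 1.
  rewrite -ler_norml -(@expr_le1 _ 2) // real_normK ?num_real //.
  by rewrite -ab1 lerDl sqr_ge0.
have E : Num.sqrt (1 - a ^+ 2) = `|b| by rewrite -ab1 addrC addKr sqrtr_sqr.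
have [b0|b0] := leP 0 b.
  exists (acos a); rewrite acosK ?in_itv //= sin_acos // E.
  by rewrite ger0_norm.
exists (- acos a); rewrite cosN sinN acosK ?in_itv //= sin_acos // E.
by rewrite ltr0_norm // opprK.
Qed.

Lemma sphere_polar (X : 'cV[R]_3) : sphere2 X ->
  exists p t : R, - (pi / 2) <= t <= pi / 2 /\ X = sphere_point p t.
Proof.
rewrite /sphere2 /= sum3 => X1.
have z1 : -1 <= X (1 + 1) 0 <= 1.
  rewrite -ler_norml -(@expr_le1 _ 2) // real_normK ?num_real //.
  by rewrite -X1 lerDr addr_ge0 ?sqr_ge0.
pose t := asin (X (1 + 1) 0).
have tpi : - (pi / 2) <= t <= pi / 2 by rewrite asin_geNpi2 ?asin_lepi2.
have st : sin t = X (1 + 1) 0 by rewrite asinK // in_itv.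
have CS := cos2Dsin2 t.
have xy : X 0 0 ^+ 2 + X 1 0 ^+ 2 = cos t ^+ 2.
  by apply: (addIr (X (1 + 1) 0 ^+ 2)); rewrite X1 -st CS.
have [p [Ex Ey]] : exists p : R, X 0 0 = cos p * cos t /\ X 1 0 = sin p * cos t.
  have [ct|ct] := eqVneq (cos t) 0.
    exists 0; rewrite ct !mulr0; move: xy; rewrite ct expr0n /= => /eqP.
    by rewrite paddr_eq0 ?sqr_ge0 // !sqrf_eq0 => /andP[/eqP -> /eqP ->].
  have [|p [Ea Eb]] := @polar_angle (X 0 0 / cos t) (X 1 0 / cos t).
    by rewrite !expr_div_n -mulrDl xy divff // expf_neq0.
  by exists p; rewrite -Ea -Eb !divfK.
exists p, t; split => //; apply/colP.
case=> [[|[|[|//]]] Hi]; rewrite !mxE /=.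
- by rewrite -Ex; congr (X _ _); exact/val_inj.
- by rewrite -Ey; congr (X _ _); exact/val_inj.
- by rewrite st; congr (X _ _); exact/val_inj.
Qed.

Lemma continuous_eq0_closed (k : R -> R) (a b : R) : a < b -> continuous k ->
  (forall x, a < x < b -> k x = 0) -> forall x, a <= x <= b -> k x = 0.
Proof.
move=> ab ck k0 x /andP[ax xb]; apply/eqP/contraT => kx.
have e0 : 0 < `|k x| by rewrite normr_gt0.
have /cvgrPdist_lt /(_ _ e0) /nbhs_ballP [d /= d0 H] := ck x.
(* A point of the open interval at distance less than [d] from [x], in the
   direction of the midpoint. *)
pose m := (a + b) / 2 - x; pose s := d / (2 * (`|m| + d)).
have m0 := normr_ge0 m.
have D0 : 0 < 2 * (`|m| + d) by lra.
have s0 : 0 < s by rewrite divr_gt0.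
have s1 : s < 1 by rewrite ltr_pdivrMr //; lra.
have sd : s * `|m| < d.
  have : s * (2 * (`|m| + d)) = d by rewrite divfK // gt_eqF.
  by have := mulr_ge0 (ltW s0) m0; have := mulr_gt0 s0 d0; lra.
have y0 : k (x + s * m) = 0 by apply: k0; rewrite /m; apply/andP; split; nra.
have := H (x + s * m); rewrite /ball /= y0 subr0 ltxx; apply.
by rewrite opprD addrA subrr sub0r normrN normrM (gtr0_norm s0).
Qed.

Section Solution.
Variables (omega : R) (F : R -> R) (psi f : 'cV[R]_3 -> R) (U : set 'cV[R]_3).
Hypotheses (oU : open U) (sU : sphere2 `<=` U) (fC2 : C2_on U f).
Hypothesis f_psi : forall X, sphere2 X -> f X = psi X.
Hypothesis pde : forall p t : R, - (pi / 2) < t < pi / 2 ->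
  laplace_beltrami psi p t = F (psi (sphere_point p t)) - 2 * omega * sin t.
Hypothesis dF : forall x, derivable F x 1.
Hypothesis F6 : forall x, - 6 < derive1 F x.

Let cF : continuous F.
Proof. by move=> x; exact/differentiable_continuous/derivable1_diffP. Qed.

Let h1 := chart_of oU sU fC2 (orthogonal_mx1 R).

Lemma chart_pde (p t : R) : - (pi / 2) < t < pi / 2 ->
  ch_lap h1 p t = F (h1 p t) - 2 * omega * sin t.
Proof.
move=> tpi; have E p' t' : psi (sphere_point p' t') = h1 p' t'.
  by rewrite chart_ofE mul1mx f_psi //; exact: sphere2_point.
by rewrite -(laplace_beltrami_chart _ E) ?gt_eqF ?cos_gt0_pihalf // pde // E.
Qed.

Lemma zonal_of_chart G (oG : orthogonal_mx G) :
  (forall p t : R, - (pi / 2) <= t <= pi / 2 ->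
    chart_of oU sU fC2 oG p t = chart_of oU sU fC2 oG 0 t) ->
  zonal (fun X => psi (G *m X)).
Proof.
move=> H; exists (fun t => f (G *m sphere_point 0 t)) => p t tpi.
rewrite -f_psi; last exact/sphere2_mulmx/sphere2_point.
exact: H.
Qed.

Lemma zonal_rotating : omega != 0 ->
  exists G : 'M[R]_3, orthogonal_mx G /\ zonal (fun X => psi (G *m X)).
Proof.
move=> omega0; exists 1%:M; split; first exact: orthogonal_mx1.
apply: (zonal_of_chart (oG := orthogonal_mx1 R)).
have [m1 m2] := moments_of_rotation omega0 cF chart_pde.
exact: (zonal_of_moments dF F6 chart_pde m1 m2).
Qed.

Section NonRotating.
Hypothesis omega0 : omega = 0.

(** The equation extends to the poles by continuity, which is needed because a
    rotation may bring them to points with regular coordinates. *)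
Lemma ambient_pde X : sphere2 X -> ambient_lap f X = F (f X).
Proof.
move=> /sphere_polar [p [t [tpi ->]]].
pose k t := ch_lap h1 p t - F (h1 p t).
have ck : continuous k.
  by have c1 := @ch_lap_cont R h1; have c2 := @ch_cont R h1; rewrite /k; cont.
have lt_pi : - (pi / 2) < pi / 2 :> R by have := pi_gt0 R; lra.
have k0 x : - (pi / 2) < x < pi / 2 -> k x = 0.
  by move=> xpi; rewrite /k chart_pde // omega0 mulr0 mul0r subr0 subrr.
have := continuous_eq0_closed lt_pi ck k0 tpi.
rewrite /k chart_of_lap chart_ofE mul1mx => /eqP.
by rewrite subr_eq0 => /eqP.
Qed.

(** The first rotation makes the first moment vanish, the second one preserves
    it and makes the second moment vanish. *)
Lemma zonal_nonrotating :
  exists G : 'M[R]_3, orthogonal_mx G /\ zonal (fun X => psi (G *m X)).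
Proof.
have [s sE] := exists_angle (moment1 h1) (moment2 h1).
have oZ := orthogonal_rot_z s.
have mZ : moment1 (chart_of oU sU fC2 oZ) = 0.
  have [M _] := moment_shift s (@ch_cont R h1) (@ch_per R h1).
  rewrite -[RHS]sE -M; congr moment1; apply/funext => p; apply/funext => t.
  by rewrite !chart_ofE rot_z_point mul1mx.
have [x [m1 m2]] := rotation_kills_moment2 mZ.
have oG := orthogonal_mxM oZ (orthogonal_rot_x x).
exists (rot_z s *m rot_x x); split => //.
apply: (zonal_of_chart (oG := oG)).
apply: (zonal_of_moments (omega := 0) dF F6 _ m1 m2) => p t _.
rewrite mulr0 mul0r subr0 chart_of_lap ambient_pde //.
exact/sphere2_mulmx/sphere2_point.
Qed.

End NonRotating.

End Solution.

End Assembly.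

Theorem theorem1 (R : realType) (omega : R) (F : R -> R)
    (psi : 'cV[R]_3 -> R)
    (F_smooth : smooth F)
    (psi_sol : classical_solution omega F psi)
    (F'_gt : forall t : R, -6 < derive1 F t) :
  exists G : 'M[R]_3, orthogonal_mx G /\ zonal (fun X => psi (G *m X)).
Proof.
have dF : forall x, derivable F x 1 := F_smooth 0%N.
have [[U [f [oU sU fC2 f_psi]]] pde] := psi_sol.
have [omega0|omega0] := eqVneq omega 0.
- exact: (zonal_nonrotating oU sU fC2 f_psi pde dF F'_gt omega0).
- exact: (zonal_rotating oU sU fC2 f_psi pde dF F'_gt omega0).
Qed.
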